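(* Let $\Bbbk$ be an algebraically closed field and let $\mathbb{P}^n$ be the projective space of dimension $n$ over $\Bbbk$. If $d,e$ are positive integers with $d\le e$, then every Cremona transformation $f\in\mathrm{Bir}(\mathbb{P}^n)$ of degree $d$ is a specialization of Cremona transformations of degrees $\ge e$.
   Context: $\mathrm{Bir}(\mathbb{P}^n)$ is the group of birational maps $\mathbb{P}^n\dashrightarrow\mathbb{P}^n$ over $\Bbbk$ (Cremona transformations). The degree $\deg(f)$ of $f\in\mathrm{Bir}(\mathbb{P}^n)$ is the common degree of homogeneous polynomials $f_0,\dots,f_n\in\Bbbk[x_0,\dots,x_n]$ of the same degree, without nontrivial common factor, such that $f=(f_0:\cdots:f_n)$. For a variety $T$, a pseudo-automorphism of $T\times \mathbb{P}^n$ over $T$ is a birational map $\varphi:T\times \mathbb{P}^n\dashrightarrow T\times \mathbb{P}^n$ for which there is a dense open $U\subset T\times \mathbb{P}^n$ such that: $\varphi$ is defined on $U$; $U_t:=U\cap(\{t\}\times \mathbb{P}^n)$ is dense in $\{t\}\times \mathbb{P}^n$ for all $t\in T$; and there is a morphism $g:U\to \mathbb{P}^n$ with $\varphi|_U(t,x)=(t,g(t,x))$ and $\varphi|_{U_t}:U_t\to\{t\}\times \mathbb{P}^n$ a birational morphism for every $t$. The induced map $T\to\mathrm{Bir}(\mathbb{P}^n)$, $t\mapsto\varphi_t$, is called a morphism from $T$ to $\mathrm{Bir}(\mathbb{P}^n)$. ''$f$ is a specialization of Cremona transformations of degrees $\ge e$'' means: there exist an irreducible variety $T$, a morphism $\theta:T\to\mathrm{Bir}(\mathbb{P}^n)$,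 a point $t_0\in T$ with $\theta(t_0)=f$, and a dense open subset $W\subset T$ such that $\deg(\theta(t))\ge e$ for all $t\in W$.
   Formalization: The formal theorem assumes n ≥ 2: for n = 1 every Cremona transformation has degree 1, so the claim fails for d = 1, e ≥ 2; for n = 0 there is no transformation of positive degree. *)

(* Defs.v *)
(* Varieties over k are treated as spaces with functions: a topological space
   together with a sheaf of k-valued functions.  The sheaf is recorded through
   its germs, i.e. by saying which functions are regular at which points. *)
From HB Require Import structures.
From mathcomp Require Import all_boot all_order all_algebra.
From mathcomp Require Import boolp classical_sets functions topology.
(* The notations of mpoly clash with those of MathComp-Analysis. *)
From mathcomp Require Import -(notations) mpoly.

Set Implicit Arguments.
Unset Strict Implicit.
Unset Printing Implicit Defensive.
Import GRing.Theory.
Local Open Scope classical_set_scope.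
Local Open Scope ring_scope.

Definition ev (k : closedFieldType) (n : nat) (p : mpoly n k) (x : 'rV[k]_n) : k :=
  meval (fun i => x ord0 i) p.

Definition homog (k : closedFieldType) (n d : nat) (p : mpoly n k) : Prop :=
  p \is ishomog1 d mdeg.

(* A function is regular on an open set when it is regular at each of its
   points, so that the gluing axiom of sheaves holds by construction; the first
   axiom says that regularity at x only depends on the germ at x. *)
Record fspace (k : closedFieldType) := FSpace {
  fcarrier :> topologicalType ;
  regular_at : fcarrier -> set (fcarrier -> k) ;
  regular_at_germ : forall x (f g : fcarrier -> k),
    (\forall y \near x, f y = g y) -> regular_at x f -> regular_at x g ;
  regular_at_near : forall x (f : fcarrier -> k),
    regular_at x f -> \forall y \near x, regular_at y f }.

(* When U is open, f restricts to a morphism U -> Y iff this holds at every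
   point of U; the values of f outside U are irrelevant. *)
Definition morphism_at (k : closedFieldType) (X Y : fspace k)
    (f : X -> Y) (x : X) : Prop :=
  {for x, continuous f} /\
  forall h : Y -> k, regular_at (f x) h -> regular_at x (h \o f).

Definition morphism_on (k : closedFieldType) (X Y : fspace k)
    (U : set X) (f : X -> Y) : Prop :=
  open U /\ forall x, U x -> morphism_at f x.

Definition isomorphic (k : closedFieldType) (X Y : fspace k) : Prop :=
  exists (f : X -> Y) (g : Y -> X),
    [/\ cancel f g, cancel g f, morphism_on setT f & morphism_on setT g].

Lemma open_subbase (T : choiceType) (D : set (set T)) :
  forall B : set T, D B ->
  [set \bigcup_(i in D') id i | D' in subset^~ (finI_from D id)] B.
Proof.
move=> B DB; exists [set B]; last by rewrite bigcup_set1.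
by move=> _ ->; exact: finI_from1.
Qed.

Definition apoint (k : closedFieldType) (m : nat) : Type := 'rV[k]_m.

HB.instance Definition _ (k : closedFieldType) (m : nat) :=
  Choice.copy (apoint k m) 'rV[k]_m.

Definition adistinguished (k : closedFieldType) (m : nat) : set (set (apoint k m)) :=
  [set B | exists p : mpoly m k, B = [set x | ev p x != 0]].

HB.instance Definition _ (k : closedFieldType) (m : nat) :=
  @isSubBaseTopological.Build (apoint k m)
    (set (apoint k m)) (@adistinguished k m) id.

Definition aregular (k : closedFieldType) (m : nat)
    (x : apoint k m) (f : apoint k m -> k) : Prop :=
  exists p q : mpoly m k,
    ev q x != 0 /\ \forall y \near x, f y = ev p y / ev q y.

Fact aregular_germ (k : closedFieldType) (m : nat) (x : apoint k m)
    (f g : apoint k m -> k) :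
  (\forall y \near x, f y = g y) -> aregular x f -> aregular x g.
Proof.
move=> fg [p [q [q0 fpq]]]; exists p, q; split=> //.
by apply: filterS2 fg fpq => y ->.
Qed.

Fact aregular_near (k : closedFieldType) (m : nat) (x : apoint k m)
    (f : apoint k m -> k) :
  aregular x f -> \forall y \near x, aregular y f.
Proof.
move=> [p [q [q0 fpq]]].
have qx : \forall y \near x, ev q y != 0.
  apply: open_nbhs_nbhs; split=> //.
  by apply: (@open_subbase (apoint k m) (@adistinguished k m)); exists q.
move/nbhs_interior: fpq => fpq.
by apply: filterS2 qx fpq => y qy fy; exists p, q.
Qed.

Definition affine_space (k : closedFieldType) (m : nat) : fspace k :=
  FSpace (@aregular_germ k m) (@aregular_near k m).

(* A point of P^n is a line of k^(n+1). *)
Definition ppoint (k : closedFieldType) (n : nat) : Type :=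
  {L : {vspace 'rV[k]_n.+1} | \dim L == 1%N}.

HB.instance Definition _ (k : closedFieldType) (n : nat) :=
  Choice.copy (ppoint k n) {L : {vspace 'rV[k]_n.+1} | \dim L == 1%N}.

Definition hcoord (k : closedFieldType) (n : nat) (x : ppoint k n) : 'rV[k]_n.+1 :=
  vpick (sval x).

Definition pdistinguished (k : closedFieldType) (n : nat) : set (set (ppoint k n)) :=
  [set B | exists (d : nat) (F : mpoly n.+1 k),
     homog d F /\ B = [set x | ev F (hcoord x) != 0]].

HB.instance Definition _ (k : closedFieldType) (n : nat) :=
  @isSubBaseTopological.Build (ppoint k n)
    (set (ppoint k n)) (@pdistinguished k n) id.

Definition pregular (k : closedFieldType) (n : nat)
    (x : ppoint k n) (f : ppoint k n -> k) : Prop :=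
  exists (d : nat) (F G : mpoly n.+1 k),
    [/\ homog d F, homog d G, ev G (hcoord x) != 0
      & \forall y \near x, f y = ev F (hcoord y) / ev G (hcoord y)].

Fact pregular_germ (k : closedFieldType) (n : nat) (x : ppoint k n)
    (f g : ppoint k n -> k) :
  (\forall y \near x, f y = g y) -> pregular x f -> pregular x g.
Proof.
move=> fg [d [F [G [hF hG G0 fFG]]]]; exists d, F, G; split=> //.
by apply: filterS2 fg fFG => y ->.
Qed.

Fact pregular_near (k : closedFieldType) (n : nat) (x : ppoint k n)
    (f : ppoint k n -> k) :
  pregular x f -> \forall y \near x, pregular y f.
Proof.
move=> [d [F [G [hF hG G0 fFG]]]].
have Gx : \forall y \near x, ev G (hcoord y) != 0.
  apply: open_nbhs_nbhs; split=> //.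
  by apply: (@open_subbase (ppoint k n) (@pdistinguished k n)); exists d, G.
move/nbhs_interior: fFG => fFG.
by apply: filterS2 Gx fFG => y Gy fy; exists d, F, G.
Qed.

Definition projective_space (k : closedFieldType) (n : nat) : fspace k :=
  FSpace (@pregular_germ k n) (@pregular_near k n).

Definition sub_regular (k : closedFieldType) (X : fspace k) (A : set X)
    (x : A) (f : A -> k) : Prop :=
  exists h : X -> k, regular_at (set_val x) h /\
    \forall y \near x, f y = h (set_val y).

Fact sub_regular_germ (k : closedFieldType) (X : fspace k) (A : set X)
    (x : A) (f g : A -> k) :
  (\forall y \near x, f y = g y) -> sub_regular x f -> sub_regular x g.
Proof.
move=> fg [h [hx fh]]; exists h; split=> //.
by apply: filterS2 fg fh => y ->.
Qed.

Fact sub_regular_near (k : closedFieldType) (X : fspace k) (A : set X)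
    (x : A) (f : A -> k) :
  sub_regular x f -> \forall y \near x, sub_regular y f.
Proof.
move=> [h [/regular_at_near hx fh]].
have {}hx : \forall y \near x, regular_at (set_val y) h.
  exact: (@initial_continuous A X set_val x) hx.
move/nbhs_interior: fh => fh.
by apply: filterS2 hx fh => y hy fy; exists h.
Qed.

Definition subspace_of (k : closedFieldType) (X : fspace k) (A : set X) : fspace k :=
  FSpace (@sub_regular_germ k X A) (@sub_regular_near k X A).

(* The topology of the product of X and Y is the one generated by the nonvanishing loci of the
    functions sum_i a_i(x) b_i(y), not the product topology. *)
Definition xpoint (k : closedFieldType) (X Y : fspace k) : Type := (X * Y)%type.

HB.instance Definition _ (k : closedFieldType) (X Y : fspace k) :=
  Choice.copy (xpoint X Y) (X * Y)%type.

Definition bisum (k : closedFieldType) (X Y : fspace k) (r : nat)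
    (a : 'I_r -> X -> k) (b : 'I_r -> Y -> k) (z : xpoint X Y) : k :=
  \sum_(i < r) a i z.1 * b i z.2.

Definition xdistinguished (k : closedFieldType) (X Y : fspace k) :
    set (set (xpoint X Y)) :=
  [set B | exists (U : set X) (V : set Y) (r : nat)
                  (a : 'I_r -> X -> k) (b : 'I_r -> Y -> k),
     [/\ open U, open V,
         (forall i x, U x -> regular_at x (a i)),
         (forall i y, V y -> regular_at y (b i))
       & B = [set z | [/\ U z.1, V z.2 & bisum a b z != 0]]]].

HB.instance Definition _ (k : closedFieldType) (X Y : fspace k) :=
  @isSubBaseTopological.Build (xpoint X Y)
    (set (xpoint X Y)) (@xdistinguished k X Y) id.

Definition xregular (k : closedFieldType) (X Y : fspace k)
    (z : xpoint X Y) (f : xpoint X Y -> k) : Prop :=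
  exists (r s : nat) (a : 'I_r -> X -> k) (b : 'I_r -> Y -> k)
         (c : 'I_s -> X -> k) (d : 'I_s -> Y -> k),
    [/\ forall i, regular_at z.1 (a i) /\ regular_at z.2 (b i),
        forall i, regular_at z.1 (c i) /\ regular_at z.2 (d i),
        bisum c d z != 0
      & \forall w \near z, f w = bisum a b w / bisum c d w].

Fact xregular_germ (k : closedFieldType) (X Y : fspace k) (z : xpoint X Y)
    (f g : xpoint X Y -> k) :
  (\forall w \near z, f w = g w) -> xregular z f -> xregular z g.
Proof.
move=> fg [r [s [a [b [c [d [rab rcd cd0 fabcd]]]]]]].
exists r, s, a, b, c, d; split=> //.
by apply: filterS2 fg fabcd => w ->.
Qed.

Fact regular_at_nbhs (k : closedFieldType) (X : fspace k) (r : nat)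
    (a : 'I_r -> X -> k) (x : X) :
  (forall i, regular_at x (a i)) ->
  exists U : set X,
    [/\ open U, U x & forall i y, U y -> regular_at y (a i)].
Proof.
move=> ra; exists (interior [set y | forall i, regular_at y (a i)]).
split; first exact: open_interior.
  by apply: filter_forall => i; apply: regular_at_near.
by move=> i y /interior_subset; apply.
Qed.

Fact xregular_near (k : closedFieldType) (X Y : fspace k) (z : xpoint X Y)
    (f : xpoint X Y -> k) :
  xregular z f -> \forall w \near z, xregular w f.
Proof.
move=> [r [s [a [b [c [d [rab rcd cd0 fabcd]]]]]]].
have [U1 [oU1 U1z aU1]] := regular_at_nbhs (fun i => (rab i).1).
have [V1 [oV1 V1z bV1]] := regular_at_nbhs (fun i => (rab i).2).
have [U2 [oU2 U2z cU2]] := regular_at_nbhs (fun i => (rcd i).1).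
have [V2 [oV2 V2z dV2]] := regular_at_nbhs (fun i => (rcd i).2).
pose B := [set w : xpoint X Y |
  [/\ (U1 `&` U2) w.1, (V1 `&` V2) w.2 & bisum c d w != 0]].
have Bz : nbhs z B.
  apply: open_nbhs_nbhs; split; last by split.
  apply: (@open_subbase (xpoint X Y) (@xdistinguished k X Y)).
  exists (U1 `&` U2), (V1 `&` V2), s, c, d; split=> //.
  - exact: openI.
  - exact: openI.
  - by move=> i x [_ /cU2].
  - by move=> i y [_ /dV2].
move/nbhs_interior: fabcd => fabcd.
apply: filterS2 Bz fabcd => w [[U1w U2w] [V1w V2w] cdw] fw.
exists r, s, a, b, c, d; split=> // i; split.
- exact: aU1.
- exact: bV1.
- exact: cU2.
- exact: dV2.
Qed.

Definition product_space (k : closedFieldType) (X Y : fspace k) : fspace k :=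
  FSpace (@xregular_germ k X Y) (@xregular_near k X Y).

Definition affine_variety (k : closedFieldType) (X : fspace k) : Prop :=
  exists (m : nat) (Z : set (affine_space k m)),
    closed Z /\ isomorphic X (subspace_of Z).

Definition variety (k : closedFieldType) (X : fspace k) : Prop :=
  (exists (r : nat) (U : 'I_r -> set X),
     [/\ forall i, open (U i),
         forall i, affine_variety (subspace_of (U i))
       & forall x, exists i, U i x]) /\
  closed [set z : product_space X X | z.1 = z.2].

Definition irreducible_space (T : topologicalType) : Prop :=
  [set: T] !=set0 /\
  forall A B : set T, closed A -> closed B ->
    A `|` B = setT -> A = setT \/ B = setT.

(* A representative of a rational map; rational maps are the classes of ratmap_eq. *)
Record ratmap (k : closedFieldType) (X Y : fspace k) := RatMap {
  rdom : set X ;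
  rfun :> X -> Y ;
  rdom_dense : dense rdom ;
  rfun_morphism : morphism_on rdom rfun }.

(* The rational map f is the class of the map g defined on U. *)
Definition represented_by (k : closedFieldType) (X Y : fspace k)
    (f : ratmap X Y) (U : set X) (g : X -> Y) : Prop :=
  exists W : set X,
    [/\ open W, dense W, W `<=` rdom f `&` U & forall x, W x -> f x = g x].

Definition ratmap_eq (k : closedFieldType) (X Y : fspace k) (f g : ratmap X Y) : Prop :=
  represented_by f (rdom g) g.

Definition birational_on (k : closedFieldType) (X Y : fspace k)
    (U : set X) (f : X -> Y) : Prop :=
  exists (U' : set X) (V : set Y) (g : Y -> X),
    [/\ dense U', dense V & U' `<=` U] /\
    [/\ morphism_on U' f, morphism_on V g,
        (forall x, U' x -> V (f x) /\ g (f x) = x)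
      & (forall y, V y -> U' (g y) /\ f (g y) = y)].

Definition birational (k : closedFieldType) (X Y : fspace k) (f : ratmap X Y) : Prop :=
  birational_on (rdom f) f.

Record Bir (k : closedFieldType) (n : nat) := BirMap {
  bir_map :> ratmap (projective_space k n) (projective_space k n) ;
  bir_birational : birational bir_map }.

(* f = (F_0 : ... : F_n) with F_0, ..., F_n homogeneous of degree d without
   nontrivial common factor.  The span of (F_0(x), ..., F_n(x)) can only be a
   point of P^n if the F_i do not all vanish at x. *)
Definition has_degree (k : closedFieldType) (n : nat) (f : Bir k n) (d : nat) : Prop :=
  exists F : 'I_n.+1 -> mpoly n.+1 k,
    [/\ forall i, homog d (F i),
        (forall G : mpoly n.+1 k,
           (forall i, exists H, F i = H * G) ->
           G \is a GRing.unit)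
      & exists W : set (projective_space k n),
          [/\ open W, dense W, W `<=` rdom f
            & forall x, W x ->
                sval (f x) = <[\row_i ev (F i) (hcoord x)]>%VS]].

(* 0 is a junk value, never used for a Cremona transformation when n > 0. *)
Definition degree (k : closedFieldType) (n : nat) (f : Bir k n) : nat :=
  xget 0%N [set d | has_degree f d].

Definition fibre (k : closedFieldType) (T P : fspace k)
    (U : set (product_space T P)) (t : T) : set P :=
  [set x | U (t, x)].

(* {t} x P^n is identified with P^n. *)
Definition pseudo_automorphism (k : closedFieldType) (n : nat) (T : fspace k)
    (phi : ratmap (product_space T (projective_space k n))
                  (product_space T (projective_space k n)))
    (U : set (product_space T (projective_space k n)))
    (g : product_space T (projective_space k n) -> projective_space k n) : Prop :=
  [/\ birational phi,
      [/\ open U, dense U, U `<=` rdom phi & forall t, dense (fibre U t)],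
      morphism_on U g,
      (forall t x, U (t, x) -> phi (t, x) = (t, g (t, x)))
    & forall t : T,
        morphism_on (fibre U t) (fun x => g (t, x)) /\
        birational_on (fibre U t) (fun x => g (t, x))].

Definition morphism_to_Bir (k : closedFieldType) (n : nat) (T : fspace k)
    (theta : T -> Bir k n) : Prop :=
  exists phi U g, pseudo_automorphism phi U g /\
    forall t, represented_by (theta t) (fibre U t) (fun x => g (t, x)).

Definition specialization_of_degrees_ge (k : closedFieldType) (n : nat)
    (f : Bir k n) (e : nat) : Prop :=
  exists T : fspace k, variety T /\ irreducible_space T /\
  exists theta : T -> Bir k n, morphism_to_Bir theta /\
    (exists t0 : T, ratmap_eq (theta t0) f) /\
    exists W : set T,
      [/\ open W, dense W & forall t, W t -> (e <= degree (theta t))%N].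

(* Main.v *)
(* Let psi_t be the shear u_2 |-> u_2 + t prod_(c in C) (u_1 - c) of the chart
   x_0 <> 0, where u_i = x_i / x_0 and C is a set of d + e elements of k.  The
   family t |-> f o psi_t, parametrised by the affine line, passes through f at
   t = 0.  Suppose that f o psi_t has degree d' < e for some t <> 0, and let F
   and F' be forms representing f and f o psi_t.  As psi_t fixes every point of
   the hyperplanes x_1 = c x_0, the forms F'_i F_j - F'_j F_i, of degree
   d + d' < #|C|, vanish on #|C| hyperplanes, so they are zero and
   f o psi_t = f.  Since f is injective on a dense open set, psi_t would be the
   identity.  No unique factorisation of polynomials is needed. *)
From mathcomp Require Import all_boot all_order all_algebra.
From mathcomp Require Import boolp classical_sets functions topology.
From mathcomp Require Import -(notations) mpoly.
Require Import Defs.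

Set Implicit Arguments.
Unset Strict Implicit.
Unset Printing Implicit Defensive.
Import GRing.Theory.
Local Open Scope classical_set_scope.
Local Open Scope ring_scope.

(** * Polynomials *)

(** The fixed hyperplanes may lie where f or f o psi_t is undefined, so the values of these maps
    cannot be compared there. The comparison is made with polynomials instead. Homogenising psi_t by
    powers of x_0 and substituting it into the F_j gives forms G_j. The relations F'_i G_j = F'_j
    G_i hold on a dense open set, because both sides describe f o psi_t, hence they hold at every
    nonzero vector. At a vector with x_0 = 1 and x_1 in C the form G_j takes the value of F_j. This
    produces the vanishing of F'_i F_j - F'_j F_i, and the root count sees only the degree d + d',
    not the degree d #|C| of the G_j.

    As [degree] falls back on the value 0, a lower bound also requires that f o psi_t has a degree
    at all; coprime forms are obtained by repeatedly cancelling a common factor of the G_j.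

    The bound n >= 2 supplies the coordinate u_2: on P^1 every birational map has degree 1. *)

Lemma subbase_base (T : choiceType) (D : set (set T)) :
  D setT -> (forall A B, D A -> D B -> D (A `&` B)) ->
  forall (A : set T) x,
    [set \bigcup_(i in D') id i | D' in subset^~ (finI_from D id)] A -> A x ->
  exists B, [/\ D B, B x & B `<=` A].
Proof.
move=> DT DI A x [D' D'D <-] [B D'B Bx].
exists B; split=> //; last by move=> y By; exists B.
have [E ED <-] := D'D _ D'B.
rewrite bigcap_fset big_seq; apply: big_ind => // C /ED.
by rewrite inE.
Qed.

Section Polynomials.
Variable k : closedFieldType.

(** Algebraic closure enters here to make the field infinite: unless [p] is constant, [p - 1] has a
    root, and there [p] takes the value 1. *)
Lemma avoid_roots (p : {poly k}) : p != 0 -> exists s, p.[s] != 0.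
Proof.
move=> p0; apply: contrapT => ps.
have /closed_rootP[t] : size (p - 1) != 1%N.
  apply/negP => /size_poly1P[c c0 pc].
  have pE : p = (c + 1)%:P by rewrite rmorphD /= -pc; rewrite subrK.
  move: p0; rewrite pE polyC_eq0 => c1.
  by apply: ps; exists 0; rewrite pE hornerC.
rewrite /root hornerD hornerN hornerC subr_eq0 => /eqP pt1.
by apply: ps; exists t; rewrite pt1 oner_neq0.
Qed.

Lemma avoid_seq (s : seq k) : exists a, a \notin s.
Proof.
have [a sa] := avoid_roots (monic_neq0 (monic_prod_XsubC s xpredT id)).
by exists a; rewrite -root_prod_XsubC.
Qed.

Lemma exists_uniq_seq (m : nat) : exists s : seq k, uniq s /\ size s = m.
Proof.
elim: m => [|m [s [us sm]]]; first by exists [::].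
by have [t ts] := avoid_seq s; exists (t :: s); rewrite /= ts us sm.
Qed.

(** The restriction of [p] to the parametrised line [v + s *: w]. It reduces questions in several
    variables to roots of a polynomial in [s]. *)
Definition on_line (n : nat) (p : mpoly n k) (v w : 'rV[k]_n) : {poly k} :=
  mmap (@polyC k) (fun i => (v ord0 i)%:P + w ord0 i *: 'X) p.

Lemma horner_on_line (n : nat) (p : mpoly n k) (v w : 'rV[k]_n) (s : k) :
  (on_line p v w).[s] = ev p (v + s *: w).
Proof.
rewrite /on_line /ev /meval /mmap horner_sum; apply: eq_bigr => m _.
rewrite hornerM hornerC /mmap1 horner_prod; congr (_ * _).
apply: eq_bigr => i _.
by rewrite horner_exp hornerD hornerC hornerZ hornerX !mxE [s * _]mulrC.
Qed.

Lemma size_on_line (n d : nat) (p : mpoly n k) (v w : 'rV[k]_n) :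
  homog d p -> (size (on_line p v w) <= d.+1)%N.
Proof.
move=> /dhomogP hp; rewrite /on_line /mmap big_seq.
apply: (leq_trans (size_sum _ _ _)); apply/bigmax_leqP_seq => m mp _.
rewrite mul_polyC; apply: (leq_trans (size_scale_leq _ _)).
have <- : mdeg m = d := hp m mp; rewrite /mmap1 mdegE.
elim/big_ind2: _ => [|q a r b|i _]; first by rewrite size_poly1.
  move=> qa rb; apply: (leq_trans (size_polyMleq _ _)).
  by rewrite -subn1 leq_subLR add1n -addSn -addnS leq_add.
apply: (leq_trans (size_poly_exp_leq _ _)).
rewrite ltnS -[leqRHS]mul1n leq_mul2r; apply/orP; right.
rewrite -subn1 leq_subLR; apply: (leq_trans (size_polyD _ _)).
rewrite geq_max (leq_trans (size_polyC_leq1 _)) //.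
by rewrite (leq_trans (size_scale_leq _ _)) // size_polyX.
Qed.

(** Both polynomials are nonzero on the line joining [v] (parameter 0) to [w] (parameter 1), so the
    product of their restrictions has a non-root. Irreducibility of affine and projective space
    rests on this. *)
Lemma common_nonzero (n : nat) (p q : mpoly n k) (v w : 'rV[k]_n) :
  ev p v != 0 -> ev q w != 0 -> exists u, ev p u != 0 /\ ev q u != 0.
Proof.
move=> pv qw.
have [|s] := @avoid_roots (on_line p v (w - v) * on_line q v (w - v)).
  rewrite mulf_eq0; apply/norP; split.
    apply: contraNneq pv => /(congr1 (horner^~ 0)).
    by rewrite horner_on_line horner0 scale0r addr0 => ->.
  apply: contraNneq qw => /(congr1 (horner^~ 1)).
  by rewrite horner_on_line horner0 scale1r addrC subrK => ->.
rewrite hornerM mulf_eq0 !horner_on_line => /norP[ps qs].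
by exists (v + s *: (w - v)).
Qed.

Lemma evM (n : nat) (p q : mpoly n k) v : ev (p * q) v = ev p v * ev q v.
Proof. exact: mevalM. Qed.

Lemma evD (n : nat) (p q : mpoly n k) v : ev (p + q) v = ev p v + ev q v.
Proof. exact: mevalD. Qed.

Lemma evB (n : nat) (p q : mpoly n k) v : ev (p - q) v = ev p v - ev q v.
Proof. exact: mevalB. Qed.

Lemma ev1 (n : nat) v : ev (1 : mpoly n k) v = 1.
Proof. exact: meval1. Qed.

Lemma ev_exp (n d : nat) (p : mpoly n k) v : ev (p ^+ d) v = ev p v ^+ d.
Proof. by elim: d => [|d IHd]; rewrite ?expr0 ?ev1 // !exprS evM IHd. Qed.

Lemma evX (n : nat) i v : ev (mpolyX k (mnm1 i) : mpoly n k) v = v ord0 i.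
Proof. exact: mevalXU. Qed.

Lemma homogX (n : nat) i : homog 1 (mpolyX k (mnm1 i) : mpoly n k).
Proof. by rewrite /homog dhomogX /= mdeg1. Qed.

Lemma homogM (n d e : nat) (p q : mpoly n k) :
  homog d p -> homog e q -> homog (d + e) (p * q).
Proof. exact: dhomogM. Qed.

Lemma homogD (n d : nat) (p q : mpoly n k) :
  homog d p -> homog d q -> homog d (p + q).
Proof. exact: rpredD. Qed.

Lemma homogB (n d : nat) (p q : mpoly n k) :
  homog d p -> homog d q -> homog d (p - q).
Proof. exact: rpredB. Qed.

Lemma homog1 (n : nat) : homog 0 (1 : mpoly n k).
Proof. exact: dhomog1. Qed.

Lemma ev_scale (n d : nat) (p : mpoly n k) (c : k) v :
  homog d p -> ev p (c *: v) = c ^+ d * ev p v.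
Proof.
move=> /dhomogP hp; rewrite /ev !mevalE big_seq [X in _ = _ * X]big_seq.
rewrite mulr_sumr; apply: eq_bigr => m mp; have <- : mdeg m = d := hp m mp.
rewrite mdegE mulrCA; congr (_ * _).
rewrite -prodrXr -big_split /=; apply: eq_bigr => i _.
by rewrite mxE exprMn.
Qed.

End Polynomials.

(** * Affine and projective spaces *)

Section Spaces.
Variable k : closedFieldType.

Lemma open_adistinguished (m : nat) (p : mpoly m k) :
  open [set x : affine_space k m | ev p x != 0].
Proof. by apply: (@open_subbase (apoint k m) (@adistinguished k m)); exists p. Qed.

Lemma open_pdistinguished (n d : nat) (F : mpoly n.+1 k) : homog d F ->
  open [set x : projective_space k n | ev F (hcoord x) != 0].
Proof.
move=> hF; apply: (@open_subbase (ppoint k n) (@pdistinguished k n)).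
by exists d, F.
Qed.

Lemma adistinguished_base (m : nat) (A : set (affine_space k m)) x :
  open A -> A x ->
  exists p : mpoly m k, ev p x != 0 /\ forall y, ev p y != 0 -> A y.
Proof.
move=> oA Ax; have [|_ _ [p ->] [q ->]|_ [[p ->] ? pA]] :=
  @subbase_base (apoint k m) (@adistinguished k m) _ _ A x oA Ax.
- by exists 1; apply/seteqP; split=> y //= _; rewrite ev1 oner_neq0.
- exists (p * q); apply/seteqP; split=> y /=; rewrite evM mulf_eq0 negb_or.
    by move=> [-> ->].
  by move=> /andP.
- by exists p.
Qed.

Lemma pdistinguished_base (n : nat) (A : set (projective_space k n)) x :
  open A -> A x ->
  exists (d : nat) (F : mpoly n.+1 k), [/\ homog d F, ev F (hcoord x) != 0
    & forall y, ev F (hcoord y) != 0 -> A y].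
Proof.
move=> oA Ax.
have [|_ _ [d [p [hp ->]]] [e [q [hq ->]]]|_ [[d [p [hp ->]]] ? pA]] :=
  @subbase_base (ppoint k n) (@pdistinguished k n) _ _ A x oA Ax.
- exists 0%N, 1; split; first exact: homog1.
  by apply/seteqP; split=> y //= _; rewrite ev1 oner_neq0.
- exists (d + e)%N, (p * q); split; first exact: homogM.
  apply/seteqP; split=> y /=; rewrite evM mulf_eq0 negb_or.
    by move=> [-> ->].
  by move=> /andP.
- by exists d, p.
Qed.

(** * Points of projective space and their representing vectors *)

Lemma hcoord_neq0 (n : nat) (x : ppoint k n) : hcoord x != 0.
Proof.
rewrite /hcoord vpick0 -dimv_eq0; case: x => L /= /eqP ->.
by [].
Qed.

Lemma hcoord_line (n : nat) (x : ppoint k n) : sval x = <[hcoord x]>%VS.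
Proof.
apply/esym/eqP; rewrite eqEdim; apply/andP; split.
  by rewrite -memvE /hcoord memv_pick.
by rewrite dim_vline hcoord_neq0; case: x => L /= /eqP ->.
Qed.

Lemma point_subproof (n : nat) (v : 'rV[k]_n.+1) :
  \dim <[(if v == 0 then delta_mx ord0 ord0 else v)%R]>%VS == 1%N.
Proof.
rewrite dim_vline; case: ifP => [_|->//]; rewrite eqb1.
by apply/eqP => /matrixP/(_ ord0 ord0)/eqP; rewrite !mxE oner_eq0.
Qed.

(* Junk value (1 : 0 : ... : 0) for v = 0. *)
Definition point (n : nat) (v : 'rV[k]_n.+1) : projective_space k n :=
  exist (fun L : {vspace 'rV[k]_n.+1} => \dim L == 1%N) _ (point_subproof v).

Lemma pointE (n : nat) (v : 'rV[k]_n.+1) : v != 0 -> sval (point v) = <[v]>%VS.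
Proof. by move=> v0; rewrite /= (negbTE v0). Qed.

Lemma line_scale (n : nat) (x : ppoint k n) (v : 'rV[k]_n.+1) :
  sval x = <[v]>%VS -> exists2 c : k, c != 0 & hcoord x = c *: v.
Proof.
move=> xv; have /vlineP[c hc] : hcoord x \in <[v]>%VS.
  by rewrite -xv /hcoord memv_pick.
by exists c => //; apply: contra_neq (hcoord_neq0 x) => c0; rewrite hc c0 scale0r.
Qed.

Lemma ev_line (n d : nat) (F : mpoly n.+1 k) (x : ppoint k n)
    (v : 'rV[k]_n.+1) :
  homog d F -> sval x = <[v]>%VS -> (ev F (hcoord x) == 0) = (ev F v == 0).
Proof.
move=> hF /line_scale[c c0 ->]; rewrite (ev_scale _ _ hF) mulf_eq0.
by rewrite (negbTE (expf_neq0 _ c0)).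
Qed.

Lemma ppoint_inj (n : nat) (x y : ppoint k n) : sval x = sval y -> x = y.
Proof. exact: val_inj. Qed.

Lemma ratio_line (n d : nat) (F G : mpoly n.+1 k) (x : ppoint k n)
    (v : 'rV[k]_n.+1) :
  homog d F -> homog d G -> sval x = <[v]>%VS ->
  ev F (hcoord x) / ev G (hcoord x) = ev F v / ev G v.
Proof.
move=> hF hG /line_scale[c c0 ->]; rewrite !(ev_scale _ _ hF) !(ev_scale _ _ hG).
by rewrite -mulf_div divff ?mul1r // expf_neq0.
Qed.

(** * Irreducibility of affine and projective space *)

Lemma projective_meet (n : nat) (A B : set (projective_space k n)) :
  open A -> open B -> A !=set0 -> B !=set0 -> A `&` B !=set0.
Proof.
move=> oA oB [x Ax] [y By].
have [d [F [hF Fx FA]]] := pdistinguished_base oA Ax.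
have [e [G [hG Gy GB]]] := pdistinguished_base oB By.
have [i xi] : exists i, hcoord x ord0 i != 0.
  by apply/rV0Pn; exact: hcoord_neq0.
(* The extra factor forces the common vector [u] to be nonzero; [F] and [G] alone would not when
   they have degree 0. *)
pose X : mpoly n.+1 k := mpolyX k (mnm1 i).
have [|u []] := @common_nonzero _ _ (F * X) G (hcoord x) (hcoord y) _ Gy.
  by rewrite evM evX mulf_neq0.
rewrite evM evX mulf_eq0 negb_or => /andP[Fu ui] Gu.
have u0 : u != 0 by apply: contra_neq ui => ->; rewrite mxE.
exists (point u); split; first by apply: FA; rewrite (ev_line hF (pointE u0)).
by apply: GB; rewrite (ev_line hG (pointE u0)).
Qed.

Lemma affine_meet (m : nat) (A B : set (affine_space k m)) :
  open A -> open B -> A !=set0 -> B !=set0 -> A `&` B !=set0.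
Proof.
move=> oA oB [x Ax] [y By].
have [p [px pA]] := adistinguished_base oA Ax.
have [q [qy qB]] := adistinguished_base oB By.
have [u [pu qu]] := common_nonzero px qy.
by exists u; split; [exact: pA | exact: qB].
Qed.

Lemma affine_irreducible (m : nat) : irreducible_space (affine_space k m).
Proof.
split; first by exists 0.
move=> A B cA cB AB; apply: contrapT => /not_orP[/eqP AT /eqP BT].
have /set0P A0 : ~` A != set0.
  by apply: contra_neq AT => A0; rewrite -[A]setCK A0 setC0.
have /set0P B0 : ~` B != set0.
  by apply: contra_neq BT => B0; rewrite -[B]setCK B0 setC0.
have [x [nAx nBx]] := affine_meet (closed_openC cA) (closed_openC cB) A0 B0.
by have : (A `|` B) x; [rewrite AB | case].
Qed.

(* An arbitrary fspace need not have these properties; without them the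
   distinguished sets of a product would not form a base of its topology. *)
Record ringed (X : fspace k) : Prop := Ringed {
  regular_cst : forall x (c : k), regular_at x (fun _ : X => c) ;
  regularD : forall x (f g : X -> k), regular_at x f -> regular_at x g ->
    regular_at x (fun y => f y + g y) ;
  regularM : forall x (f g : X -> k), regular_at x f -> regular_at x g ->
    regular_at x (fun y => f y * g y) ;
  regularV : forall x (f : X -> k), regular_at x f -> f x != 0 ->
    regular_at x (fun y => (f y)^-1) ;
  regular_neq0 : forall x (f : X -> k), regular_at x f -> f x != 0 ->
    \forall y \near x, f y != 0 }.

Lemma affine_ringed (m : nat) : ringed (affine_space k m).
Proof.
have nz (p : mpoly m k) (x : affine_space k m) :
    ev p x != 0 -> \forall y \near x, ev p y != 0.
  by move=> px; apply: open_nbhs_nbhs; split=> //; exact: open_adistinguished.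
split.
- move=> x c; exists (mpolyC m c), 1; rewrite ev1 oner_neq0; split=> //.
  by apply: (filterE (nbhs_filter x)) => y; rewrite ev1 /ev mevalC divr1.
- move=> x f g [p [q [qx fE]]] [p' [q' [q'x gE]]].
  exists (p * q' + p' * q), (q * q'); split; rewrite ?evM ?mulf_neq0 //.
  apply: filterS3 (filterI fE gE) (nz _ _ qx) (nz _ _ q'x) => y [-> ->] qy q'y.
  by rewrite evD !evM addf_div.
- move=> x f g [p [q [qx fE]]] [p' [q' [q'x gE]]].
  exists (p * p'), (q * q'); split; rewrite ?evM ?mulf_neq0 //.
  by apply: filterS2 fE gE => y -> ->; rewrite !evM mulf_div.
- move=> x f [p [q [qx fE]]] fx; exists q, p; split.
    by apply: contra_neq fx => p0; rewrite (nbhs_singleton fE) p0 mul0r.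
  by apply: filterS fE => y ->; rewrite invf_div.
- move=> x f [p [q [qx fE]]] fx.
  have px : ev p x != 0.
    by apply: contra_neq fx => p0; rewrite (nbhs_singleton fE) p0 mul0r.
  apply: filterS3 fE (nz _ _ px) (nz _ _ qx) => y -> py qy.
  by rewrite mulf_neq0 ?invr_eq0.
Qed.

Lemma projective_ringed (n : nat) : ringed (projective_space k n).
Proof.
have nz d (F : mpoly n.+1 k) (x : projective_space k n) : homog d F ->
    ev F (hcoord x) != 0 -> \forall y \near x, ev F (hcoord y) != 0.
  move=> hF Fx; apply: open_nbhs_nbhs; split=> //.
  exact: open_pdistinguished hF.
split.
- move=> x c; exists 0%N, (mpolyC n.+1 c), 1; rewrite ev1 oner_neq0; split=> //.
  + by rewrite -[mpolyC _ _]mulr1 mul_mpolyC; apply: dhomogZ; exact: homog1.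
  + exact: homog1.
  + by apply: (filterE (nbhs_filter x)) => y; rewrite ev1 /ev mevalC divr1.
- move=> x f g [d [p [q [hp hq qx fE]]]] [d' [p' [q' [hp' hq' q'x gE]]]].
  exists (d + d')%N, (p * q' + p' * q), (q * q'); split; rewrite ?evM ?mulf_neq0 //.
  + by apply: homogD; [|rewrite mulrC]; exact: homogM.
  + exact: homogM.
  apply: filterS3 (filterI fE gE) (nz _ _ _ hq qx) (nz _ _ _ hq' q'x).
  by move=> y [-> ->] qy q'y; rewrite evD !evM addf_div.
- move=> x f g [d [p [q [hp hq qx fE]]]] [d' [p' [q' [hp' hq' q'x gE]]]].
  exists (d + d')%N, (p * p'), (q * q'); split; rewrite ?evM ?mulf_neq0 //.
  + exact: homogM.
  + exact: homogM.
  by apply: filterS2 fE gE => y -> ->; rewrite !evM mulf_div.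
- move=> x f [d [p [q [hp hq qx fE]]]] fx; exists d, q, p; split=> //.
    by apply: contra_neq fx => p0; rewrite (nbhs_singleton fE) p0 mul0r.
  by apply: filterS fE => y ->; rewrite invf_div.
- move=> x f [d [p [q [hp hq qx fE]]]] fx.
  have px : ev p (hcoord x) != 0.
    by apply: contra_neq fx => p0; rewrite (nbhs_singleton fE) p0 mul0r.
  apply: filterS3 fE (nz _ _ _ hp px) (nz _ _ _ hq qx) => y -> py qy.
  by rewrite mulf_neq0 ?invr_eq0.
Qed.

End Spaces.

(** * Products and morphisms *)

Section Morphisms.
Variable k : closedFieldType.
Implicit Types X Y Z : fspace k.

(** The image of the tensor product of [A] and [B] among the functions on the product. [A] and [B]
    will be the functions regular at a point, or those regular on an open set. *)
Definition tensor X Y (A : set (X -> k)) (B : set (Y -> k))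
    (f : xpoint X Y -> k) : Prop :=
  exists (r : nat) (a : 'I_r -> X -> k) (b : 'I_r -> Y -> k),
    (forall i, A (a i) /\ B (b i)) /\ f = bisum a b.

(** Sums and products of tensors are naturally indexed by a disjoint union or a product of index
    types; this renumbers them by ordinals. *)
Lemma tensor_fin X Y A B (I : finType) (a : I -> X -> k) (b : I -> Y -> k) :
  (forall i, A (a i) /\ B (b i)) ->
  tensor A B (fun z => \sum_i a i z.1 * b i z.2).
Proof.
move=> ab; exists #|I|, (fun j => a (enum_val j)), (fun j => b (enum_val j)).
split=> //; apply/funext => z; rewrite /bisum.
by rewrite -[RHS](big_enum_val (A := I) (fun i => a i z.1 * b i z.2)).
Qed.

Lemma tensor1 X Y A B (a : X -> k) (b : Y -> k) :
  A a -> B b -> tensor A B (fun z => a z.1 * b z.2).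
Proof.
move=> Aa Bb; exists 1%N, (fun=> a), (fun=> b); split=> //.
by apply/funext => z; rewrite /bisum big_ord1.
Qed.

Lemma tensor_fst X Y (A : set (X -> k)) (B : set (Y -> k)) (a : X -> k) :
  A a -> B (fun=> 1) -> tensor A B (fun z => a z.1).
Proof.
move=> Aa B1; have := tensor1 Aa B1; congr tensor.
by apply/funext => z; rewrite mulr1.
Qed.

Lemma tensor_snd X Y (A : set (X -> k)) (B : set (Y -> k)) (b : Y -> k) :
  A (fun=> 1) -> B b -> tensor A B (fun z => b z.2).
Proof.
move=> A1 Bb; have := tensor1 A1 Bb; congr tensor.
by apply/funext => z; rewrite mul1r.
Qed.

Lemma tensorD X Y (A : set (X -> k)) (B : set (Y -> k)) f g :
  tensor A B f -> tensor A B g -> tensor A B (fun z => f z + g z).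
Proof.
move=> [r [a [b [ab ->]]]] [s [c [d [cd ->]]]].
have := @tensor_fin X Y A B ('I_r + 'I_s)%type
  (fun i => match i with inl j => a j | inr j => c j end)
  (fun i => match i with inl j => b j | inr j => d j end).
set h := fun z => _; have -> : h = (fun z => bisum a b z + bisum c d z).
  by apply/funext => z; rewrite /h big_sumType.
by apply; case.
Qed.

Lemma tensorM X Y (A : set (X -> k)) (B : set (Y -> k)) f g :
  (forall a c, A a -> A c -> A (fun x => a x * c x)) ->
  (forall b d, B b -> B d -> B (fun y => b y * d y)) ->
  tensor A B f -> tensor A B g -> tensor A B (fun z => f z * g z).
Proof.
move=> AM BM [r [a [b [ab ->]]]] [s [c [d [cd ->]]]].
have := @tensor_fin X Y A B ('I_r * 'I_s)%type
  (fun i x => a i.1 x * c i.2 x) (fun i y => b i.1 y * d i.2 y).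
set h := fun z => _; have -> : h = (fun z => bisum a b z * bisum c d z).
  apply/funext => z; rewrite /bisum big_distrlr /= pair_bigA /=.
  by apply: eq_bigr => i _; rewrite mulrACA.
apply=> i; have [Aa Bb] := ab i.1; have [Ac Bd] := cd i.2.
by split; [exact: AM | exact: BM].
Qed.

Lemma xregularP X Y (z : product_space X Y) (f : product_space X Y -> k) :
  regular_at z f <-> exists p q,
    [/\ tensor (regular_at z.1) (regular_at z.2) p,
        tensor (regular_at z.1) (regular_at z.2) q,
        q z != 0 & \forall w \near z, f w = p w / q w].
Proof.
split=> [[r [s [a [b [c [d [ab cd nz fE]]]]]]]|].
  by exists (bisum a b), (bisum c d); split=> //; [exists r, a, b|exists s, c, d].
move=> [_ [_ [[r [a [b [ab ->]]]] [s [c [d [cd ->]]]] nz fE]]].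
by exists r, s, a, b, c, d.
Qed.

Lemma open_xdistinguished X Y (U : set X) (V : set Y) p :
  open U -> open V ->
  tensor [set a | forall x, U x -> regular_at x a]
         [set b | forall y, V y -> regular_at y b] p ->
  open [set z : product_space X Y | [/\ U z.1, V z.2 & p z != 0]].
Proof.
move=> oU oV [r [a [b [ab ->]]]].
apply: (@open_subbase (xpoint X Y) (@xdistinguished k X Y)).
by exists U, V, r, a, b; split=> // i; [exact: (ab i).1 | exact: (ab i).2].
Qed.

Lemma tensor_neq0 X Y (z : product_space X Y) p :
  tensor (regular_at z.1) (regular_at z.2) p -> p z != 0 ->
  \forall w \near z, p w != 0.
Proof.
move=> [r [a [b [ab ->]]]] pz.
have [U [oU Uz aU]] := regular_at_nbhs (fun i => (ab i).1).
have [V [oV Vz bV]] := regular_at_nbhs (fun i => (ab i).2).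
apply: (@filterS _ (nbhs z) _ [set w | [/\ U w.1, V w.2 & bisum a b w != 0]]).
  by move=> w [].
apply: open_nbhs_nbhs; split; last by split.
apply: open_xdistinguished => //; exists r, a, b; split=> // i.
by split=> x; [exact: aU | exact: bV].
Qed.

Lemma product_ringed X Y : ringed X -> ringed Y -> ringed (product_space X Y).
Proof.
move=> rX rY.
have tM (z : product_space X Y) p q :
    tensor (regular_at z.1) (regular_at z.2) p ->
    tensor (regular_at z.1) (regular_at z.2) q ->
    tensor (regular_at z.1) (regular_at z.2) (fun w => p w * q w).
  by apply: tensorM; [exact: regularM rX _ | exact: regularM rY _].
have tC (z : product_space X Y) (c : k) :
    tensor (regular_at z.1) (regular_at z.2) (fun=> c : k).
  by apply: (tensor_fst (a := fun=> c)); exact: regular_cst.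
split.
- move=> z c; apply/xregularP; exists (fun=> c), (fun=> 1).
  split; rewrite ?oner_neq0 //.
  by apply: (filterE (nbhs_filter z)) => w; rewrite divr1.
- move=> z f g /xregularP[p [q [tp tq qz fE]]].
  move=> /xregularP[p' [q' [tp' tq' q'z gE]]].
  apply/xregularP.
  exists (fun w => p w * q' w + p' w * q w), (fun w => q w * q' w).
  split; [|exact: tM|exact: mulf_neq0|].
    by apply: tensorD; exact: tM.
  apply: filterS3 (filterI fE gE) (tensor_neq0 tq qz) (tensor_neq0 tq' q'z).
  by move=> w [-> ->] qw q'w; rewrite addf_div.
- move=> z f g /xregularP[p [q [tp tq qz fE]]].
  move=> /xregularP[p' [q' [tp' tq' q'z gE]]].
  apply/xregularP; exists (fun w => p w * p' w), (fun w => q w * q' w).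
  split; [exact: tM|exact: tM|exact: mulf_neq0|].
  by apply: filterS2 fE gE => w -> ->; rewrite mulf_div.
- move=> z f /xregularP[p [q [tp tq qz fE]]] fz; apply/xregularP; exists q, p.
  split=> //.
    by apply: contra_neq fz => p0; rewrite (nbhs_singleton fE) p0 mul0r.
  by apply: filterS fE => w ->; rewrite invf_div.
- move=> z f /xregularP[p [q [tp tq qz fE]]] fz.
  have pz : p z != 0.
    by apply: contra_neq fz => p0; rewrite (nbhs_singleton fE) p0 mul0r.
  apply: filterS3 fE (tensor_neq0 tp pz) (tensor_neq0 tq qz) => w -> pw qw.
  by rewrite mulf_neq0 ?invr_eq0.
Qed.

Lemma xdistinguished_base X Y (A : set (product_space X Y)) z :
  ringed X -> ringed Y -> open A -> A z ->
  exists (U : set X) (V : set Y) p,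
    [/\ open U, open V,
        tensor [set a | forall x, U x -> regular_at x a]
               [set b | forall y, V y -> regular_at y b] p,
        [/\ U z.1, V z.2 & p z != 0]
      & forall w, U w.1 -> V w.2 -> p w != 0 -> A w].
Proof.
move=> rX rY oA Az.
have DP (B : set (xpoint X Y)) : xdistinguished B <->
    exists (U : set X) (V : set Y) p, [/\ open U, open V,
      tensor [set a | forall x, U x -> regular_at x a]
             [set b | forall y, V y -> regular_at y b] p
      & B = [set z | [/\ U z.1, V z.2 & p z != 0]]].
  split=> [[U [V [r [a [b [oU oV aU bV ->]]]]]]|].
    exists U, V, (bisum a b); split=> //; exists r, a, b; split=> // i.
    by split; [exact: aU | exact: bV].
  move=> [U [V [_ [oU oV [r [a [b [ab ->]]]] ->]]]].
  by exists U, V, r, a, b; split=> // i; [exact: (ab i).1 | exact: (ab i).2].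
have [||_ [/DP[U [V [p [oU oV tp ->]]]] Uz pA]] :=
  @subbase_base (xpoint X Y) (@xdistinguished k X Y) _ _ A z oA Az.
- apply/DP; exists setT, setT, (fun=> 1 : k); split; [exact: openT|exact: openT| |].
    by apply: (tensor_fst (a := fun=> 1)) => ? _; exact: regular_cst.
  by apply/seteqP; split=> w //= _; rewrite oner_neq0.
- move=> _ _ /DP[U [V [p [oU oV tp ->]]]] /DP[U' [V' [p' [oU' oV' tp' ->]]]].
  (* Two nonvanishing loci meet in the nonvanishing locus of the product, which is again a tensor
     since regular functions are closed under multiplication. *)
  apply/DP; exists (U `&` U'), (V `&` V'), (fun z => p z * p' z).
  have sub (A1 A2 : set (X -> k)) (B1 B2 : set (Y -> k)) q :
    A1 `<=` A2 -> B1 `<=` B2 -> tensor A1 B1 q -> tensor A2 B2 q.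
    move=> sA sB [r [a [b [ab ->]]]]; exists r, a, b; split=> // i.
    by split; [apply/sA/(ab i).1 | apply/sB/(ab i).2].
  split; [exact: openI|exact: openI| |].
    apply: tensorM.
    + move=> a c aU cU x Ux; apply: (regularM rX); [exact: aU|exact: cU].
    + move=> a c aU cU x Ux; apply: (regularM rY); [exact: aU|exact: cU].
    + by apply: sub tp => a aU x [? ?]; exact: aU.
    + by apply: sub tp' => a aU x [? ?]; exact: aU.
  apply/seteqP; split=> w /=; rewrite mulf_eq0 negb_or.
    by move=> [[? ? ->] [? ? ->]].
  by move=> [[? ?] [? ?] /andP[-> ->]].
- by exists U, V, p; split=> // w ? ? ?; exact: pA.
Qed.

Lemma regular_sum Z (z : Z) (I : Type) (s : seq I) (f : I -> Z -> k) :
  ringed Z -> (forall i, regular_at z (f i)) ->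
  regular_at z (fun w => \sum_(i <- s) f i w).
Proof.
move=> rZ rf; elim: s => [|i s IHs].
  have -> : (fun w => \sum_(i <- [::]) f i w) = (fun=> 0).
    by apply/funext => w; rewrite big_nil.
  exact: regular_cst.
have -> : (fun w => \sum_(i <- i :: s) f i w)
    = (fun w => f i w + \sum_(i <- s) f i w).
  by apply/funext => w; rewrite big_cons.
exact: regularD.
Qed.

Lemma regular_prod Z (z : Z) (I : Type) (s : seq I) (f : I -> Z -> k) :
  ringed Z -> (forall i, regular_at z (f i)) ->
  regular_at z (fun w => \prod_(i <- s) f i w).
Proof.
move=> rZ rf; elim: s => [|i s IHs].
  have -> : (fun w => \prod_(i <- [::]) f i w) = (fun=> 1).
    by apply/funext => w; rewrite big_nil.
  exact: regular_cst.
have -> : (fun w => \prod_(i <- i :: s) f i w)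
    = (fun w => f i w * \prod_(i <- s) f i w).
  by apply/funext => w; rewrite big_cons.
exact: regularM.
Qed.

Lemma regularX Z (z : Z) (f : Z -> k) d :
  ringed Z -> regular_at z f -> regular_at z (fun w => f w ^+ d).
Proof.
move=> rZ rf; elim: d => [|d IHd]; first exact: regular_cst.
have -> : (fun w => f w ^+ d.+1) = (fun w => f w * f w ^+ d).
  by apply/funext => w; rewrite exprS.
exact: regularM.
Qed.

Lemma regular_ev Z (z : Z) (m : nat) (p : mpoly m k) (c : 'I_m -> Z -> k) :
  ringed Z -> (forall i, regular_at z (c i)) ->
  regular_at z (fun w => ev p (\row_i c i w)).
Proof.
move=> rZ rc.
have -> : (fun w => ev p (\row_i c i w)) =
    (fun w => \sum_(u <- msupp p) mcoeff u p * \prod_i c i w ^+ u i).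
  apply/funext => w; rewrite /ev mevalE; apply: eq_bigr => u _.
  by congr (_ * _); apply: eq_bigr => i _; rewrite mxE.
apply: regular_sum => // u; apply: (regularM rZ); first exact: regular_cst.
by apply: regular_prod => // i; exact: regularX.
Qed.

(** * Morphisms to and from products and to projective space *)

Lemma morphism_at_comp X Y Z (f : X -> Y) (g : Y -> Z) x :
  morphism_at f x -> morphism_at g (f x) -> morphism_at (fun y => g (f y)) x.
Proof.
move=> [cf rf] [cg rg]; split; first exact: continuous_comp cf cg.
by move=> h /rg/rf.
Qed.

Lemma morphism_at_id X (x : X) : morphism_at (fun y : X => y) x.
Proof. by split. Qed.

Lemma morphism_at_cst X Y (y : Y) (x : X) : ringed X -> morphism_at (fun=> y) x.
Proof.
move=> rX; split; first exact: cst_continuous.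
by move=> h _; exact: regular_cst.
Qed.

(** Continuity of [a] and [b] alone is too weak, the topology of the product being finer than the
    product topology. A basic open set is also cut out by a tensor [p], whose pullback
    [p (a w, b w)] is regular on [Z] and so stays nonzero near [z]. *)
Lemma morphism_at_pair X Y Z (a : Z -> X) (b : Z -> Y) z :
  ringed X -> ringed Y -> ringed Z -> morphism_at a z -> morphism_at b z ->
  morphism_at (fun w => (a w, b w) : product_space X Y) z.
Proof.
move=> rX rY rZ [ca ra] [cb rb].
have rT p : tensor (regular_at (a z)) (regular_at (b z)) p ->
    regular_at z (fun w => p (a w, b w)).
  move=> [r [u [v [uv ->]]]]; apply: regular_sum => // i.
  by apply: (regularM rZ); [exact: (ra _ (uv i).1) | exact: (rb _ (uv i).2)].
have cab : {for z, continuous (fun w => (a w, b w) : product_space X Y)}.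
  move=> A; rewrite nbhsE => -[B [oB Bz] BA].
  have [U [V [p [oU oV [r [u [v [uv ->]]]] [Uz Vz pz] UB]]]] :=
    xdistinguished_base rX rY oB Bz.
  have tp : tensor (regular_at (a z)) (regular_at (b z)) (bisum u v).
    by exists r, u, v; split=> // i; split; [exact: (uv i).1 | exact: (uv i).2].
  suff: nbhs z [set w | A (a w, b w)] by [].
  have Ua : nbhs z [set w | U (a w)] := ca _ (open_nbhs_nbhs (conj oU Uz)).
  have Vb : nbhs z [set w | V (b w)] := cb _ (open_nbhs_nbhs (conj oV Vz)).
  apply: filterS3 Ua Vb (regular_neq0 rZ (rT _ tp) pz).
  by move=> w Uw Vw pw; apply: BA; exact: UB.
split=> // h /xregularP[p [q [tp tq qz hE]]].
apply: (@regular_at_germ _ _ _ (fun w => p (a w, b w) / q (a w, b w))).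
  have {}hE : nbhs z [set w | h (a w, b w) = p (a w, b w) / q (a w, b w)].
    exact: cab _ hE.
  by apply: filterS hE => w /= ->.
by apply: (regularM rZ); [exact: rT|apply: (regularV rZ) => //; exact: rT].
Qed.

Lemma morphism_at_fst X Y (z : product_space X Y) : ringed X -> ringed Y ->
  morphism_at (fun w : product_space X Y => w.1) z.
Proof.
move=> rX rY.
split.
  move=> A; rewrite nbhsE => -[B [oB Bz] BA].
  suff: nbhs z [set w | A w.1] by [].
  apply: (@filterS _ (nbhs z) _ [set w | [/\ B w.1, setT w.2 & 1 != 0 :> k]]).
    by move=> w [Bw _ _]; exact: BA.
  apply: open_nbhs_nbhs; split; last by split; rewrite ?oner_neq0.
  apply: (@open_xdistinguished X Y _ _ (fun=> 1)) => //; first exact: openT.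
  by apply: (tensor_fst (a := fun=> 1)) => ? _; exact: regular_cst.
move=> h rh; apply/xregularP; exists (fun w => h w.1), (fun=> 1).
split; rewrite ?oner_neq0 //.
- by apply: tensor_fst => //; exact: regular_cst.
- by apply: (tensor_fst (a := fun=> 1)); exact: regular_cst.
- by apply: (filterE (nbhs_filter z)) => w; rewrite /= divr1.
Qed.

Lemma morphism_at_snd X Y (z : product_space X Y) : ringed X -> ringed Y ->
  morphism_at (fun w : product_space X Y => w.2) z.
Proof.
move=> rX rY.
split.
  move=> A; rewrite nbhsE => -[B [oB Bz] BA].
  suff: nbhs z [set w | A w.2] by [].
  apply: (@filterS _ (nbhs z) _ [set w | [/\ setT w.1, B w.2 & 1 != 0 :> k]]).
    by move=> w [_ Bw _]; exact: BA.
  apply: open_nbhs_nbhs; split; last by split; rewrite ?oner_neq0.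
  apply: (@open_xdistinguished X Y _ _ (fun=> 1)) => //; first exact: openT.
  by apply: (tensor_fst (a := fun=> 1)) => ? _; exact: regular_cst.
move=> h rh; apply/xregularP; exists (fun w => h w.2), (fun=> 1).
split; rewrite ?oner_neq0 //.
- by apply: tensor_snd => //; exact: regular_cst.
- by apply: (tensor_fst (a := fun=> 1)); exact: regular_cst.
- by apply: (filterE (nbhs_filter z)) => w; rewrite /= divr1.
Qed.

(** The representative [hcoord (h w)] is an arbitrary choice and need not vary regularly with [w].
    Vanishing of a form and ratios of forms of equal degree do not depend on it, so they can be
    computed from the regular coordinates [c i]. *)
Lemma morphism_at_point Z (n : nat) (h : Z -> projective_space k n)
    (c : 'I_n.+1 -> Z -> k) z :
  ringed Z -> (forall i, regular_at z (c i)) ->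
  (\forall w \near z, sval (h w) = <[\row_i c i w]>%VS) -> morphism_at h z.
Proof.
move=> rZ rc hE.
have hz := nbhs_singleton hE.
have ch : {for z, continuous h}.
  move=> A; rewrite nbhsE => -[B [oB Bz] BA].
  have [d [F [hF Fz FB]]] := pdistinguished_base oB Bz.
  have := regular_neq0 rZ (regular_ev F rZ rc).
  rewrite -(ev_line hF hz) => /(_ Fz) Fw.
  suff: nbhs z [set w | A (h w)] by [].
  by apply: filterS2 hE Fw => w hw Fw; apply/BA/FB; rewrite (ev_line hF hw).
split=> // g [d [F [G [hF hG Gz gE]]]].
apply: (@regular_at_germ _ _ _
  (fun w => ev F (\row_i c i w) / ev G (\row_i c i w))).
  have {}gE : nbhs z
      [set w | g (h w) = ev F (hcoord (h w)) / ev G (hcoord (h w))].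
    exact: ch _ gE.
  apply: filterS2 hE gE => w hw /= ->.
  by rewrite (ratio_line hF hG hw).
apply: (regularM rZ); first exact: regular_ev.
apply: (regularV rZ); first exact: regular_ev.
by rewrite -(ev_line hG hz).
Qed.

Lemma open_regular_neq0 Z (f : Z -> k) :
  ringed Z -> (forall z, regular_at z f) -> open [set z | f z != 0].
Proof.
by move=> rZ rf; rewrite openE => z fz; exact: (regular_neq0 rZ (rf z) fz).
Qed.

Lemma regular_coord (m : nat) (i : 'I_m) (x : affine_space k m) :
  regular_at x (fun y : affine_space k m => (y : 'rV[k]_m) ord0 i).
Proof.
exists (mpolyX k (mnm1 i)), 1; rewrite ev1 oner_neq0; split=> //.
by apply: (filterE (nbhs_filter x)) => y; rewrite evX ev1 divr1.
Qed.

Lemma affine_space_variety (m : nat) : variety (affine_space k m).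
Proof.
split.
  exists 1%N, (fun=> setT); split=> [_|_|x]; first exact: openT.
    exists m, setT; split; first exact: closedT.
    have id1 : morphism_on setT (@id (subspace_of [set: affine_space k m])).
      by split=> [|x _]; [exact: openT | exact: morphism_at_id].
    by exists id, id.
  by exists ord0.
have rA := @affine_ringed k m; have rAA := product_ringed rA rA.
pose AA := product_space (affine_space k m) (affine_space k m).
(* Separatedness: the diagonal is the common zero locus of the regular functions x_i - y_i. *)
rewrite (_ : [set _ | _] = \bigcap_(i : 'I_m) ~` [set z : AA |
  (z.1 : 'rV[k]_m) ord0 i - (z.2 : 'rV[k]_m) ord0 i != 0]).
  apply: closed_bigI => i _; apply: open_closedC.
  apply: (open_regular_neq0 rAA) => z; apply: (regularD rAA).
    exact: (morphism_at_fst z rA rA).2 (regular_coord i z.1).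
  have -> : (fun y : AA =>
    - (y.2 : 'rV[k]_m) ord0 i) = (fun y => -1 * (y.2 : 'rV[k]_m) ord0 i).
    by apply/funext => y; rewrite mulN1r.
  apply: (regularM rAA); first exact: regular_cst.
  exact: (morphism_at_snd z rA rA).2 (regular_coord i z.2).
apply/seteqP; split=> -[x y] /= => [-> i _|xy]; first by
  rewrite /setC /= subrr eqxx.
apply/rowP => i; apply/eqP; rewrite -subr_eq0; apply/negPn/negP.
exact: xy.
Qed.

End Morphisms.

(** * Degrees *)

Section Degree.
Variable k : closedFieldType.

Definition topform (n : nat) (p : mpoly n k) : mpoly n k :=
  pihomog mdeg (msize p).-1 p.

Lemma homog_topform (n : nat) (p : mpoly n k) : homog (msize p).-1 (topform p).
Proof. exact: pihomogP. Qed.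

Lemma homog_msize_le (n d : nat) (p : mpoly n k) :
  homog d p -> (msize p <= d.+1)%N.
Proof.
move=> hp; rewrite msizeE; apply/bigmax_leqP_seq => m mp _.
by have -> : mdeg m = d := dhomog_mf hp mp.
Qed.

Lemma homog_msize (n d : nat) (p : mpoly n k) :
  homog d p -> p != 0 -> msize p = d.+1.
Proof.
move=> hp p0; have := dhomog_uniq p0 hp (dhomog_msize hp).
move=> ->; rewrite prednK // lt0n.
by apply: contra_neq p0 => /eqP; rewrite msize_poly_eq0 => /eqP.
Qed.

Lemma pihomog_msize (n d : nat) (p : mpoly n k) :
  (msize p <= d)%N -> pihomog mdeg d p = 0.
Proof.
move=> pd; rewrite pihomogE big_seq_cond big1 // => m /andP[mp /eqP md].
by have := msize_mdeg_lt mp; rewrite -[mdeg m]/(mdeg m : nat) md ltnNge pd.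
Qed.

(* The factors of a homogeneous polynomial are homogeneous; it is quicker to
   check that they may be replaced by their forms of top degree. *)
Lemma homog_factor (n d : nat) (p h g : mpoly n k) :
  homog d p -> p != 0 -> p = h * g ->
  p = topform h * topform g /\ ((msize h).-1 + (msize g).-1)%N = d.
Proof.
move=> hp p0 pE.
have [h0 g0] : h != 0 /\ g != 0.
  by apply/andP; rewrite -negb_or -mulf_eq0 -pE.
have [h1 g1] : (0 < msize h)%N /\ (0 < msize g)%N by rewrite !lt0n !msize_poly_eq0.
have dE : ((msize h).-1 + (msize g).-1)%N = d.
  apply: succn_inj; rewrite -(homog_msize hp p0) pE msizeM //.
  by rewrite -[in RHS](prednK h1) -[in RHS](prednK g1) addSn addnS.
split=> //.
(* Each factor is its top form plus terms of lower degree, so the component of degree [d] of [h * g]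
   is the product of the two top forms. *)
have low (q : mpoly n k) : (0 < msize q)%N ->
    exists2 r, q = r + topform q & (msize r <= (msize q).-1)%N.
  move=> q1; exists (\sum_(i < (msize q).-1) pihomog mdeg i q).
    rewrite {1}[q](@pihomog_partitionE _ _ mdeg (msize q).-1.+1) ?leqSpred //.
    by rewrite big_ord_recr.
  apply: (leq_trans (msize_sum _ _ _)); apply/bigmax_leqP => i _.
  exact: leq_trans (homog_msize_le (pihomogP _ _ _)) (ltn_ord i).
have sM (q r : mpoly n k) : (msize (q * r) <= (msize q + msize r).-1)%N.
  have [->|q0] := eqVneq q 0; first by rewrite mul0r msize0.
  have [->|r0] := eqVneq r 0; first by rewrite mulr0 msize0.
  by rewrite msizeM.
have [h' hE sh] := low h h1; have [g' gE sg] := low g g1.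
have -> : p = pihomog mdeg d (h * g) by rewrite -pE pihomog_dE.
rewrite {1}hE mulrDl {2}gE mulrDr !raddfD /=.
have -> : pihomog mdeg d (h' * g) = 0.
  apply: pihomog_msize; apply: leq_trans (sM _ _) _.
  by rewrite -dE -subn1 leq_subLR add1n -addnS leq_add // prednK.
have -> : pihomog mdeg d (topform h * g') = 0.
  apply: pihomog_msize; apply: leq_trans (sM _ _) _.
  rewrite -dE -subn1 leq_subLR add1n -addSn leq_add //.
  exact: homog_msize_le (homog_topform _).
rewrite !add0r.
by rewrite pihomog_dE // -dE; exact: homogM (homog_topform _) (homog_topform _).
Qed.

Lemma line_scalev (n : nat) (c : k) (v : 'rV[k]_n) : c != 0 ->
  <[c *: v]>%VS = <[v]>%VS.
Proof.
move=> c0; apply/eqP; rewrite eqEsubv -!memvE; apply/andP; split.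
  by rewrite rpredZ // memv_line.
by rewrite -{1}[v](scalerK c0) rpredZ // memv_line.
Qed.

Lemma nonzero_line (n : nat) (x : ppoint k n) (v : 'rV[k]_n.+1) :
  sval x = <[v]>%VS -> v != 0.
Proof.
move=> xv; apply/eqP => v0; have := svalP x.
by rewrite /= xv v0 dimv0.
Qed.

(** A positive value cannot be the default 0 of [xget], so it is a genuine degree. *)
Lemma degree_spec (n d : nat) (f : Bir k n) :
  (0 < d)%N -> degree f = d -> has_degree f d.
Proof.
rewrite /degree; case: xgetP => [d' -> fd' _ <- //|_ d0 /esym d0'].
by rewrite d0' in d0.
Qed.

(** [degree] selects some admissible degree, so the bound is asked of all of them; existence
    excludes the default 0. *)
Lemma degree_ge (n e : nat) (f : Bir k n) :
  (exists d, has_degree f d) -> (forall d, has_degree f d -> (e <= d)%N) ->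
  (e <= degree f)%N.
Proof.
move=> [d fd] fe; rewrite /degree; case: xgetP => [d' _ /fe //|/(_ d)].
by [].
Qed.

(** As long as the forms share a nonunit factor, it is cancelled. Such a factor is nonzero of
    positive degree, so the degree of the forms drops and the process ends with coprime forms. *)
Lemma has_degree_of_forms (n d : nat) (f : Bir k n)
    (F : 'I_n.+1 -> mpoly n.+1 k) (W : set (projective_space k n)) :
  (forall i, homog d (F i)) -> open W -> dense W -> W `<=` rdom f ->
  (forall x, W x -> sval (f x) = <[\row_i ev (F i) (hcoord x)]>%VS) ->
  exists d', has_degree f d'.
Proof.
move=> hF oW dW Wf; elim/ltn_ind: d F hF => d IHd F hF FW.
have [coprime|] := pselect (forall G : mpoly n.+1 k,
  (forall i, exists H, F i = H * G) -> G \is a GRing.unit).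
  by exists d, F; split=> //; exists W.
move=> /existsNP[G /not_implyP[/choice[H FHG] nuG]].
(* At a point of [W] the values of the forms span a line, so the forms are not all zero and neither
   is [G]. *)
have [x [_ Wx]] : setT `&` W !=set0.
  apply: dW; last exact: openT.
  by exists (point (delta_mx ord0 ord0)).
have [i Fi0] : exists i, F i != 0.
  have /rV0Pn[i] := nonzero_line (FW x Wx).
  rewrite mxE => Fi; exists i; apply: contra_neq Fi => ->.
  by rewrite /ev meval0.
have G0 : G != 0 by apply: contra_neq Fi0 => G0; rewrite FHG G0 mulr0.
have G1 : (0 < (msize G).-1)%N.
  rewrite lt0n; apply/eqP => G1; apply: nuG.
  have /msize1_polyC GE : (msize G <= 1)%N by rewrite -subn_eq0 subn1 G1.
  rewrite GE rmorph_unit // unitfE; apply: contra_neq G0 => c0.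
  by rewrite GE c0 mpolyC0.
(* [homog_factor] concerns nonzero products, so zero forms are treated apart; zero is homogeneous of
   the common degree [d - (msize G).-1] as well. *)
pose F' i := if F i == 0 then 0 else topform (H i).
have FE j : F j = F' j * topform G.
  rewrite /F'; case: eqVneq => [->|Fj0]; first by rewrite mul0r.
  exact: (homog_factor (hF j) Fj0 (FHG j)).1.
have dG : ((msize G).-1 <= d)%N.
  by rewrite -(homog_factor (hF i) Fi0 (FHG i)).2 leq_addl.
apply: (IHd (d - (msize G).-1)%N _ F') => [|j|y Wy].
- by rewrite ltn_subrL G1 (leq_trans G1 dG).
- rewrite /F'; case: eqVneq => [_|Fj0]; first exact: dhomog0.
  rewrite -(homog_factor (hF j) Fj0 (FHG j)).2 addnK.
  exact: homog_topform.
have rowE : \row_j ev (F j) (hcoord y) =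
    ev (topform G) (hcoord y) *: \row_j ev (F' j) (hcoord y).
  by apply/rowP => j; rewrite !mxE FE evM mulrC.
(* The cancelled factor cannot vanish on [W], where the row of the [F j] is nonzero; dividing by it
   leaves the line unchanged. *)
rewrite (FW y Wy) rowE line_scalev //.
have := nonzero_line (FW y Wy); rewrite rowE.
by apply: contra_neq => ->; rewrite scale0r.
Qed.

End Degree.

(** * Shears *)

Lemma open_preimage (k : closedFieldType) (X Y : fspace k) (f : X -> Y)
    (A : set X) (B : set Y) :
  open A -> open B -> (forall x, A x -> morphism_at f x) ->
  open [set x | A x /\ B (f x)].
Proof.
move=> oA oB fA; rewrite openE => x [Ax Bfx].
have nA : nbhs x A by exact: open_nbhs_nbhs.
have nB : nbhs x [set y | B (f y)] by apply: (fA x Ax).1; exact: open_nbhs_nbhs.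
by apply: filterS2 nA nB.
Qed.

Section Shear.
Variables (k : closedFieldType) (n : nat) (cs : seq k).
Hypothesis hn : (2 <= n)%N.
Notation P := (projective_space k n).
Notation i1 := (inord 1 : 'I_n.+1).
Notation i2 := (inord 2 : 'I_n.+1).

Let i10 : i1 == ord0 = false.
Proof. by rewrite -val_eqE /= inordK // ltnS (ltn_trans _ hn). Qed.

Let i20 : i2 == ord0 = false.
Proof. by rewrite -val_eqE /= inordK. Qed.

Let i12 : i1 == i2 = false.
Proof. by rewrite -val_eqE /= !inordK // ltnS (ltn_trans _ hn). Qed.

Definition chart : set P := [set x | hcoord x ord0 ord0 != 0].

Definition chart_coord (x : P) : 'rV[k]_n.+1 :=
  (hcoord x ord0 ord0)^-1 *: hcoord x.

Definition shear (t : k) (u : 'rV[k]_n.+1) : 'rV[k]_n.+1 :=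
  \row_i (u ord0 i + (i == i2)%:R * (t * \prod_(c <- cs) (u ord0 i1 - c))).

Definition shear_map (t : k) (x : P) : P := point (shear t (chart_coord x)).

Lemma shear_head t u : shear t u ord0 ord0 = u ord0 ord0.
Proof. by rewrite mxE eq_sym i20 mul0r addr0. Qed.

(** The added term depends only on coordinate 1, which the shear leaves alone. *)
Lemma shearK t u : shear (- t) (shear t u) = u.
Proof.
apply/rowP => i; rewrite !mxE i12 mul0r addr0 mulNr mulrN.
by rewrite addrK.
Qed.

Lemma shear0 u : shear 0 u = u.
Proof. by apply/rowP => i; rewrite mxE mul0r mulr0 addr0. Qed.

Lemma shear_fixed t (u : 'rV[k]_n.+1) : u ord0 i1 \in cs -> shear t u = u.
Proof.
move=> ucs; apply/rowP => i; rewrite mxE (big_rem _ ucs) /= subrr mul0r mulr0.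
by rewrite mulr0 addr0.
Qed.

Lemma shear_moved t (u : 'rV[k]_n.+1) :
  t != 0 -> u ord0 i1 \notin cs -> shear t u != u.
Proof.
move=> t0 ucs; apply/eqP => /rowP/(_ i2); rewrite mxE eqxx mul1r.
move=> /eqP; rewrite -subr_eq0 addrC addKr mulf_eq0 (negbTE t0) /=.
rewrite prodf_seq_eq0 => /hasP[c ccs /=]; rewrite subr_eq0 => /eqP uc.
by rewrite uc ccs in ucs.
Qed.

Lemma open_chart : open chart.
Proof.
have -> : chart =
    [set x : P | ev (mpolyX k (mnm1 ord0) : mpoly n.+1 k) (hcoord x) != 0].
  by apply/seteqP; split=> x; rewrite /chart /= evX.
exact: open_pdistinguished (homogX _ _).
Qed.

Lemma chart_coord_head x : chart x -> chart_coord x ord0 ord0 = 1.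
Proof. by move=> x0; rewrite mxE mulVf. Qed.

Lemma chart_coord_line x : chart x -> sval x = <[chart_coord x]>%VS.
Proof. by move=> x0; rewrite line_scalev ?invr_eq0 // -hcoord_line. Qed.

Lemma chart_coord_uniq x (v : 'rV[k]_n.+1) :
  v ord0 ord0 = 1 -> sval x = <[v]>%VS -> chart x /\ chart_coord x = v.
Proof.
move=> v1 /line_scale[c c0 xv]; rewrite /chart /chart_coord /= xv mxE v1 mulr1.
by split=> //; rewrite scalerA mulVf ?scale1r.
Qed.

Lemma head1_neq0 (v : 'rV[k]_n.+1) : v ord0 ord0 = 1 -> v != 0.
Proof.
by move=> v1; apply: contra_eq_neq v1 => ->; rewrite mxE eq_sym oner_eq0.
Qed.

Lemma shear_map_line t x : chart x ->
  sval (shear_map t x) = <[shear t (chart_coord x)]>%VS.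
Proof.
by move=> x0; rewrite pointE // head1_neq0 // shear_head chart_coord_head.
Qed.

Lemma shear_map_chart t x : chart x ->
  chart (shear_map t x) /\
  chart_coord (shear_map t x) = shear t (chart_coord x).
Proof.
move=> x0; apply: chart_coord_uniq; last exact: shear_map_line.
by rewrite shear_head chart_coord_head.
Qed.

Lemma shear_mapK t x : chart x -> shear_map (- t) (shear_map t x) = x.
Proof.
move=> x0; have [y0 yE] := shear_map_chart t x0.
apply: ppoint_inj; rewrite shear_map_line // yE shearK.
by rewrite -chart_coord_line.
Qed.

Lemma shear_map0 x : chart x -> shear_map 0 x = x.
Proof.
by move=> x0; apply: ppoint_inj; rewrite shear_map_line // shear0 -chart_coord_line.
Qed.

Lemma regular_chart_coord x i : chart x ->
  regular_at x (fun y : P => chart_coord y ord0 i).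
Proof.
move=> x0; exists 1%N, (mpolyX k (mnm1 i)), (mpolyX k (mnm1 ord0)).
rewrite evX; split=> //; [exact: homogX|exact: homogX|].
by apply: (filterE (nbhs_filter x)) => y; rewrite !evX mxE mulrC.
Qed.

(** Parameter and point vary together, so that one lemma serves a single shear (constant [s]) and
    the whole family over the affine line. *)
Lemma morphism_at_shear_map (Z : fspace k) (s : Z -> k) (f : Z -> P) z :
  ringed Z -> regular_at z s -> morphism_at f z -> chart (f z) ->
  morphism_at (fun w => shear_map (s w) (f w)) z.
Proof.
move=> rZ rs mf fz.
have rf i : regular_at z (fun w => chart_coord (f w) ord0 i).
  exact: mf.2 (regular_chart_coord i fz).
apply: (morphism_at_point
  (c := fun i w => shear (s w) (chart_coord (f w)) ord0 i)) => //.
  move=> i; rewrite /shear.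
  have -> : (fun w => (\row_i0 (chart_coord (f w) ord0 i0 + (i0 == i2)%:R *
      (s w * \prod_(c <- cs) (chart_coord (f w) ord0 i1 - c)))) ord0 i) =
      (fun w => chart_coord (f w) ord0 i + (i == i2)%:R *
      (s w * \prod_(c <- cs) (chart_coord (f w) ord0 i1 + (- c)))).
    by apply/funext => w; rewrite mxE.
  apply: (regularD rZ) => //; apply: (regularM rZ); first exact: regular_cst.
  apply: (regularM rZ) => //; apply: regular_prod => // c.
  by apply: (regularD rZ) => //; exact: regular_cst.
have nf : nbhs z [set w | chart (f w)].
  by apply: mf.1; apply: open_nbhs_nbhs; split=> //; exact: open_chart.
apply: filterS nf => w fw; rewrite shear_map_line //.
by congr <[_]>%VS; apply/rowP => i; rewrite [RHS]mxE.
Qed.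

(** The homogenised shear: coordinate [i] of [shear cs t], taken at x / x_0 and multiplied by x_0 to
    the power [size cs]. The exponent [(size cs).-1] makes the first term homogeneous of that degree
    when [cs] is nonempty. *)
Definition shear_form (t : k) (i : 'I_n.+1) : mpoly n.+1 k :=
  let X j : mpoly n.+1 k := mpolyX k (mnm1 j) in
  X i * X ord0 ^+ (size cs).-1 +
  (if i == i2 then mpolyC n.+1 t * \prod_(c <- cs) (X i1 - c *: X ord0) else 0).

Lemma homog_prod_lin (s : seq k) (j l : 'I_n.+1) :
  homog (size s) (\prod_(c <- s)
    ((mpolyX k (mnm1 j) : mpoly n.+1 k) - c *: mpolyX k (mnm1 l))).
Proof.
elim: s => [|c s IHs]; first by rewrite big_nil; exact: homog1.
rewrite big_cons; apply: (@homogM _ _ 1%N) => //; apply: homogB.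
  exact: homogX.
exact: dhomogZ (homogX _ _).
Qed.

Lemma homog_shear_form t i : (0 < size cs)%N -> homog (size cs) (shear_form t i).
Proof.
move=> cs0; apply: homogD.
  rewrite -[in homog _](prednK cs0).
  apply: (@homogM _ _ 1%N); first exact: homogX.
  by have := dhomogMn (size cs).-1 (homogX k (ord0 : 'I_n.+1)); rewrite mul1n.
case: ifP => _; last exact: dhomog0.
by rewrite mul_mpolyC; apply: dhomogZ; exact: homog_prod_lin.
Qed.

Lemma ev_shear_form t (v : 'rV[k]_n.+1) : (0 < size cs)%N -> v ord0 ord0 != 0 ->
  \row_i ev (shear_form t i) v =
  v ord0 ord0 ^+ size cs *: shear t ((v ord0 ord0)^-1 *: v).
Proof.
move=> cs0 v0; apply/rowP => i; rewrite !mxE /shear_form evD evM evX.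
rewrite mulrDr; congr (_ + _).
  rewrite -{2}(prednK cs0) exprS ev_exp evX.
  by rewrite mulrACA mulfV // mul1r mulrC.
case: ifP => _; last by rewrite /ev meval0 mul0r mulr0.
rewrite mul1r evM /ev mevalC mulrCA; congr (_ * _).
rewrite -[meval _ _]/(ev _ v).
elim: (cs) => [|c s IHs]; first by rewrite !big_nil expr0 mul1r ev1.
rewrite !big_cons evM IHs exprS mulrACA; congr (_ * _).
rewrite evB evX /ev mevalZ mevalXU mulrBr mulrA mulfV // mul1r.
by rewrite [_ * c]mulrC.
Qed.

End Shear.

(** * Degrees of sheared maps *)

Section ShearDegree.
Variable k : closedFieldType.

Lemma homog_comp (N M d m : nat) (F : mpoly N k) (q : 'I_N -> mpoly M k) :
  homog d F -> (forall i, homog m (q i)) ->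
  exists G : mpoly M k, homog (m * d) G /\
    forall v, ev G v = ev F (\row_i ev (q i) v).
Proof.
move=> /dhomogP hF hq; exists (comp_mpoly [tuple q i | i < N] F); split=> [|v].
  rewrite comp_mpolyE big_seq; apply: rpred_sum => u Fu; apply: dhomogZ.
  have <- : mdeg u = d := hF u Fu; rewrite mdegE big_distrr /=.
  elim/big_ind2: _ => [|p a r b|i _]; [exact: dhomog1|exact: dhomogM|].
  by rewrite tnth_mktuple; apply: dhomogMn; exact: hq.
rewrite /ev comp_mpoly_meval; apply: meval_eq => i.
by rewrite tnth_mktuple mxE.
Qed.

(** If nonempty, the open locus where [Q] does not vanish would meet [A]. *)
Lemma homog_vanish (n d : nat) (Q : mpoly n.+1 k)
    (A : set (projective_space k n)) :
  homog d Q -> open A -> A !=set0 -> (forall x, A x -> ev Q (hcoord x) = 0) ->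
  forall v : 'rV[k]_n.+1, v != 0 -> ev Q v = 0.
Proof.
move=> hQ oA A0 QA v v0; apply/eqP/negPn/negP => Qv.
have [|x [Ax /negP]] := projective_meet oA (open_pdistinguished hQ) A0.
  by exists (point v); rewrite /= (ev_line hQ (pointE v0)).
by apply; rewrite QA.
Qed.

(** The hypothesis says that the 2 by 2 minors of the pair vanish, so the vectors are
    proportional. *)
Lemma parallel_line (n : nat) (v w : 'rV[k]_n) :
  v != 0 -> w != 0 ->
  (forall i j, v ord0 i * w ord0 j = v ord0 j * w ord0 i) ->
  <[v]>%VS = <[w]>%VS.
Proof.
move=> v0 /rV0Pn[i wi] vw.
have vE : v = (v ord0 i / w ord0 i) *: w.
  by apply/rowP => j; rewrite !mxE mulrAC vw mulfK.
rewrite vE line_scalev //; apply: contra_neq v0 => c0.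
by rewrite vE c0 scale0r.
Qed.

Lemma line_parallel (n : nat) (v w : 'rV[k]_n) : <[v]>%VS = <[w]>%VS ->
  forall i j, v ord0 i * w ord0 j = v ord0 j * w ord0 i.
Proof.
move=> vw; have /vlineP[c ->] : v \in <[w]>%VS by rewrite -vw memv_line.
by move=> i j; rewrite !mxE mulrAC.
Qed.

Variables (n : nat) (cs : seq k).
Hypothesis hn : (2 <= n)%N.
Notation P := (projective_space k n).

Lemma form_shear_map (d : nat) (F : mpoly n.+1 k) t : homog d F ->
  (0 < size cs)%N ->
  exists G : mpoly n.+1 k, homog (size cs * d) G /\
    forall v : 'rV[k]_n.+1, v ord0 ord0 != 0 ->
    ev G v = (v ord0 ord0 ^+ size cs) ^+ d *
      ev F (shear cs t ((v ord0 ord0)^-1 *: v)).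
Proof.
move=> hF cs0.
have [G [hG GE]] := homog_comp hF (fun i => homog_shear_form t i cs0).
exists G; split=> // v v0.
by rewrite GE ev_shear_form // (ev_scale _ _ hF).
Qed.

Lemma projective_dense (A : set P) : open A -> A !=set0 -> dense A.
Proof. by move=> oA A0 B B0 oB; exact: projective_meet. Qed.

Lemma projective_dense_neq0 (A : set P) : dense A -> A !=set0.
Proof.
move=> dA; have [|x [_ Ax]] := dA setT _ openT; last by exists x.
by exists (point (delta_mx ord0 ord0)).
Qed.

Lemma chart_neq0 : @chart k n !=set0.
Proof.
pose v : 'rV[k]_n.+1 := delta_mx ord0 ord0.
have v1 : v ord0 ord0 = 1 by rewrite mxE !eqxx.
exists (point v); apply: (chart_coord_uniq v1 _).1.
by rewrite pointE // head1_neq0.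
Qed.

Lemma morphism_at_shear t (x : P) : chart x -> morphism_at (shear_map cs t) x.
Proof.
have rP := @projective_ringed k n.
move=> x0; apply: (@morphism_at_shear_map _ _ cs hn P (fun=> t) id x) => //.
  exact: regular_cst.
exact: morphism_at_id.
Qed.

Lemma open_shear_preimage t (A : set P) : open A ->
  open [set x | chart x /\ A (shear_map cs t x)].
Proof.
move=> oA; apply: open_preimage => //; first exact: open_chart.
exact: morphism_at_shear.
Qed.

Lemma shear_preimage_neq0 t (A : set P) : open A -> A !=set0 ->
  [set x | chart x /\ A (shear_map cs t x)] !=set0.
Proof.
move=> oA A0.
have [x [x0 Ax]] := projective_meet (@open_chart k n) oA chart_neq0 A0.
exists (shear_map cs (- t) x); split; first exact: (shear_map_chart _ _ _ _).1.
by rewrite -[t in shear_map cs t _]opprK shear_mapK.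
Qed.

(** Substituting the sheared coordinates gives forms of degree [size cs * d], which may share a
    factor; hence only the existence of a degree is claimed. *)
Lemma has_degree_shear (f h : Bir k n) t d (W : set P) :
  (0 < size cs)%N -> has_degree f d -> open W -> dense W -> W `<=` rdom h ->
  (forall x, W x -> chart x /\ h x = f (shear_map cs t x)) ->
  exists d', has_degree h d'.
Proof.
move=> cs0 [F [hF _ [W1 [oW1 dW1 W1f FE]]]] oW dW Wh hE.
have /choice[G GE] := fun i => form_shear_map t (hF i) cs0.
pose W2 := [set x | chart x /\ W1 (shear_map cs t x)].
have oW2 : open W2 by exact: open_shear_preimage.
have W20 : W2 !=set0.
  by apply: shear_preimage_neq0 => //; exact: projective_dense_neq0.
apply: (@has_degree_of_forms k n (size cs * d) h G (W `&` W2)).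
- by move=> i; exact: (GE i).1.
- exact: openI.
- apply: projective_dense; first exact: openI.
  exact: projective_meet (projective_dense_neq0 dW) W20.
- by move=> x [/Wh].
move=> x [/hE[x0 ->] [_ W1x]]; rewrite FE //.
have [c c0 ->] := line_scale (shear_map_line cs hn t x0).
have -> : \row_i ev (G i) (hcoord x) =
    ((hcoord x ord0 ord0) ^+ size cs) ^+ d *:
    \row_i ev (F i) (shear cs t (chart_coord x)).
  by apply/rowP => i; rewrite !mxE (GE i).2.
rewrite line_scalev ?expf_neq0 //.
have -> : \row_i ev (F i) (c *: shear cs t (chart_coord x)) =
    c ^+ d *: \row_i ev (F i) (shear cs t (chart_coord x)).
  by apply/rowP => i; rewrite !mxE (ev_scale _ _ (hF i)).
by rewrite line_scalev ?expf_neq0.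
Qed.

(** On the line through [v] along coordinate 1, which keeps x_0 = 1, [R] restricts to a polynomial
    of degree at most [D] with [size cs] distinct roots. It is zero, in particular at parameter 0,
    which is [v]. *)
Lemma homog_vanish_hyperplanes (D : nat) (R : mpoly n.+1 k) :
  homog D R -> uniq cs -> (D < size cs)%N ->
  (forall v : 'rV[k]_n.+1,
    v ord0 ord0 = 1 -> v ord0 (inord 1) \in cs -> ev R v = 0) ->
  forall v : 'rV[k]_n.+1, v ord0 ord0 = 1 -> ev R v = 0.
Proof.
move=> hR ucs Dcs Rcs v v1.
pose w : 'rV[k]_n.+1 := delta_mx ord0 (inord 1).
have w0 : w ord0 ord0 = 0.
  by rewrite mxE eqxx -val_eqE /= inordK // ltnS (ltn_trans _ hn).
have w1 : w ord0 (inord 1) = 1 by rewrite mxE !eqxx.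
(* These are the parameters at which the line crosses the hyperplanes x_1 = c x_0. *)
pose rs := [seq c - v ord0 (inord 1) | c <- cs].
have R0 : on_line R v w = 0.
  apply: (@roots_geq_poly_eq0 _ _ rs).
  - apply/allP => _ /mapP[c ccs ->]; apply/eqP; rewrite horner_on_line.
    have vwE j : (v + (c - v ord0 (inord 1)) *: w) ord0 j =
        v ord0 j + (c - v ord0 (inord 1)) * w ord0 j by rewrite mxE [X in _ + X]mxE.
    by apply: Rcs; rewrite vwE ?w0 ?mulr0 ?addr0 // w1 mulr1 addrC subrK.
  - by rewrite map_inj_uniq // => x y /addIr.
  - by rewrite size_map (leq_trans (size_on_line _ _ hR)).
by rewrite -[v]addr0 -(scale0r w) -horner_on_line R0 horner0.
Qed.

Lemma off_hyperplanes :
  let N := [set x : P | chart x /\ chart_coord x ord0 (inord 1) \notin cs] in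
  open N /\ N !=set0.
Proof.
have rP := @projective_ringed k n; split.
  rewrite openE => x [x0 xcs].
  pose q (y : P) := \prod_(c <- cs) (chart_coord y ord0 (inord 1) + - c).
  have qE y : (q y != 0) = (chart_coord y ord0 (inord 1) \notin cs).
    rewrite -(root_prod_XsubC cs) /root horner_prod.
    by congr (_ != 0); apply: eq_bigr => c _; rewrite hornerXsubC.
  have rq : regular_at x q.
    apply: regular_prod => // c; apply: (regularD rP).
      exact: regular_chart_coord.
    exact: regular_cst.
  have nx : nbhs x (@chart k n).
    by apply: open_nbhs_nbhs; split=> //; exact: open_chart.
  have nq : nbhs x [set y | q y != 0] by apply: (regular_neq0 rP rq); rewrite qE.
  by apply: filterS2 nx nq => y y0; rewrite /= qE.
have [a acs] := avoid_seq cs.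
pose v : 'rV[k]_n.+1 := \row_i (if i == ord0 then 1 else a).
have v1 : v ord0 ord0 = 1 by rewrite mxE eqxx.
have [x0 xE] := chart_coord_uniq v1 (pointE (head1_neq0 v1)).
exists (point v); split=> //=; rewrite xE mxE -val_eqE /= inordK //.
by rewrite ltnS (ltn_trans _ hn).
Qed.

(** [A] is a set on which [f] is injective: it turns the final equality of [f] at [x] and at its
    shear into a fixed point of the shear off the hyperplanes, which is absurd. *)
Lemma degree_shear_ge (f h : Bir k n) t d d' (A W : set P) :
  t != 0 -> uniq cs -> (0 < size cs)%N -> has_degree f d -> has_degree h d' ->
  open A -> A !=set0 ->
  (forall x y, A x -> A y -> f x = f y -> x = y) ->
  open W -> W !=set0 ->
  (forall x, W x ->
    [/\ chart x, A (shear_map cs t x) & h x = f (shear_map cs t x)]) ->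
  (size cs <= d + d')%N.
Proof.
move=> t0 ucs cs0 [F [hF _ [W1 [oW1 dW1 W1f FE]]]].
move=> [F' [hF' _ [W2 [oW2 dW2 W2h F'E]]]] oA A0 finj oW W0 hE.
rewrite leqNgt; apply/negP => ddcs.
have /choice[G GE] := fun i => form_shear_map t (hF i) cs0.
pose V := [set x | chart x /\ W1 (shear_map cs t x)].
have oV : open V by exact: open_shear_preimage.
have V0 : V !=set0.
  by apply: shear_preimage_neq0 => //; exact: projective_dense_neq0.
have oVW : open (W `&` (W2 `&` V)) by apply: openI => //; exact: openI.
have VW0 : W `&` (W2 `&` V) !=set0.
  apply: projective_meet => //; first exact: openI.
  by apply: projective_meet => //; exact: projective_dense_neq0.
(* On the open set of [VW0] the rows of the [F' i] and of the [G i] represent the same point. As a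
   polynomial identity this extends to all nonzero vectors, including those on the hyperplanes. *)
have F'G i j (v : 'rV[k]_n.+1) : v != 0 -> ev (F' i * G j - F' j * G i) v = 0.
  apply: (homog_vanish _ oVW VW0) => [|x [/hE[x0 Ax hx] [W2x [_ W1x]]]].
    by apply: homogB; apply: homogM => //; exact: (GE _).1.
  have := F'E x W2x; rewrite hx FE //.
  have [c c0 ->] := line_scale (shear_map_line cs hn t x0).
  move=> /line_parallel/(_ j i); rewrite !mxE !(ev_scale _ _ (hF _)).
  rewrite -!mulrA => /(mulfI (expf_neq0 _ c0)) FF.
  rewrite evB !evM !(GE _).2 //.
  rewrite -[_^-1 *: _]/(chart_coord x).
  rewrite mulrCA [X in _ - X]mulrCA -mulrBr ![ev (F' _) _ * _]mulrC FF.
  by rewrite subrr mulr0.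
have F'F i j (v : 'rV[k]_n.+1) : v ord0 ord0 = 1 ->
    ev (F' i) v * ev (F j) v = ev (F' j) v * ev (F i) v.
  move=> v1; apply/eqP; rewrite -subr_eq0 -!evM -evB; apply/eqP.
  move: v v1; apply: (@homog_vanish_hyperplanes (d' + d)) => //.
  - by apply: homogB; exact: homogM.
  - by rewrite addnC.
  (* Here the powers of x_0 are 1 and the shear fixes [v], so [G i] takes the value of [F i]. *)
  move=> v v1 vcs; have := F'G i j v (head1_neq0 v1).
  rewrite !evB !evM !(GE _).2 v1 ?oner_neq0 // !expr1n !mul1r invr1 scale1r.
  by rewrite shear_fixed.
pose N := [set x : P | chart x /\ chart_coord x ord0 (inord 1) \notin cs].
have [oN N0] : open N /\ N !=set0 by exact: off_hyperplanes.
(* A point off the hyperplanes where both systems of forms compute their maps and where [x] and its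
   shear both lie in [A]. *)
have meet5 : A `&` (N `&` (W1 `&` (W2 `&` W))) !=set0.
  have oW2W := openI oW2 oW; have oW1W := openI oW1 oW2W.
  have oNW := openI oN oW1W.
  do !apply: projective_meet => //; exact: projective_dense_neq0.
have [x [Ax [[x0 xcs] [W1x [W2x Wx]]]]] := meet5.
have [_ Asx hx] := hE x Wx.
suff sx : shear_map cs t x = x.
  have := shear_moved t0 xcs.
  by rewrite -(shear_map_chart cs hn t x0).2 sx eqxx.
apply: finj => //; rewrite -hx; apply: ppoint_inj.
have Fx := FE x W1x; have F'x := F'E x W2x; rewrite Fx F'x.
apply: parallel_line; [exact: nonzero_line F'x|exact: nonzero_line Fx|].
(* [F'F] is stated for vectors with x_0 = 1, so [hcoord x] is replaced by a multiple of
   [chart_coord x]. *)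
have [c c0 ->] := line_scale (chart_coord_line x0).
move: (chart_coord x) (chart_coord_head x0) => u u1 i j.
rewrite !mxE !(ev_scale _ _ (hF _)) !(ev_scale _ _ (hF' _)).
by rewrite mulrACA F'F // mulrACA.
Qed.

End ShearDegree.

(** * The family of sheared maps *)

Section Fibres.
Variables (k : closedFieldType) (T P : fspace k).
Hypotheses (rT : ringed T) (rP : ringed P).

Lemma morphism_at_slice (t : T) (x : P) :
  morphism_at (fun y : P => (t, y) : product_space T P) x.
Proof.
by apply: morphism_at_pair => //; [exact: morphism_at_cst | exact: morphism_at_id].
Qed.

Lemma open_fibre (S : set (product_space T P)) t : open S -> open (fibre S t).
Proof.
move=> oS; have -> : fibre S t =
    [set x : P | setT x /\ S ((t, x) : product_space T P)].
  by apply/seteqP; split=> y //= [].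
apply: (@open_preimage _ P (product_space T P) (fun x => (t, x))) => //.
  exact: openT.
by move=> y _; exact: morphism_at_slice.
Qed.

(** A nonempty open set of the product has a nonempty slice, open because the slice inclusion is a
    morphism; [S] already meets it in that slice. *)
Lemma dense_fibres (S : set (product_space T P)) :
  (forall t, dense (fibre S t)) -> dense S.
Proof.
move=> dS O [[t x] Otx] oO.
have [|y [Oy Sy]] := dS t _ _ (open_fibre t oO); first by exists x.
by exists (t, y).
Qed.

End Fibres.

Section Family.
Variables (k : closedFieldType) (n : nat) (cs : seq k) (f : Bir k n).
Hypothesis hn : (2 <= n)%N.
Notation P := (projective_space k n).
Notation A1 := (affine_space k 1).
Notation AP := (product_space A1 P).

(** Mutually inverse isomorphisms between open sets, as given by the birationality of [f]. *)
Variables (U0 V0 : set P) (g0 : P -> P).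
Hypotheses (U0f : U0 `<=` rdom f) (dU0 : dense U0) (dV0 : dense V0).
Hypotheses (mf : morphism_on U0 f) (mg : morphism_on V0 g0).
Hypothesis fK : forall x, U0 x -> V0 (f x) /\ g0 (f x) = x.
Hypothesis gK : forall y, V0 y -> U0 (g0 y) /\ f (g0 y) = y.

Let rA : ringed A1. Proof. exact: affine_ringed. Qed.
Let rP : ringed P. Proof. exact: projective_ringed. Qed.
Let rAP : ringed AP. Proof. exact: product_ringed. Qed.

Definition param (t : A1) : k := (t : 'rV[k]_1) ord0 ord0.

Definition family (z : AP) : P := f (shear_map cs (param z.1) z.2).

(** Cut down to [U0] rather than [rdom f], so that each fibre is matched bijectively with a fibre of
    [family_cod]. *)
Definition family_dom : set AP :=
  [set z | chart z.2 /\ U0 (shear_map cs (param z.1) z.2)].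

Definition family_inv (z : AP) : P := shear_map cs (- param z.1) (g0 z.2).

(** The condition does not involve the parameter, since every shear maps the chart onto itself. *)
Definition family_cod : set AP := [set z | V0 z.2 /\ chart (g0 z.2)].

Lemma regular_param (z : AP) : regular_at z (fun w : AP => param w.1).
Proof. exact: (morphism_at_fst z rA rP).2 (regular_coord ord0 z.1). Qed.

Lemma morphism_family (z : AP) : family_dom z -> morphism_at family z.
Proof.
move=> [z0 Uz].
have ms : morphism_at (fun w : AP => shear_map cs (param w.1) w.2) z.
  apply: morphism_at_shear_map => //; first exact: regular_param.
  exact: morphism_at_snd.
exact: morphism_at_comp ms (mf.2 _ Uz).
Qed.

Lemma morphism_family_inv (z : AP) : family_cod z -> morphism_at family_inv z.
Proof.
move=> [Vz z0]; apply: morphism_at_shear_map => //.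
  have -> : (fun w : AP => - param w.1) = (fun w : AP => -1 * param w.1).
    by apply/funext => w; rewrite mulN1r.
  by apply: (regularM rAP); [exact: regular_cst | exact: regular_param].
exact: morphism_at_comp (morphism_at_snd z rA rP) (mg.2 _ Vz).
Qed.

Lemma open_family_dom : open family_dom.
Proof.
have oC : open [set z : AP | chart z.2].
  have -> : [set z : AP | chart z.2] = [set z : AP | setT z /\ chart z.2].
    by apply/seteqP; split=> z //= [].
  apply: open_preimage; [exact: openT|exact: open_chart|].
  by move=> z _; exact: morphism_at_snd.
apply: open_preimage => //; first exact: mf.1.
move=> z z0; apply: morphism_at_shear_map => //; first exact: regular_param.
exact: morphism_at_snd.
Qed.

Lemma open_family_cod : open family_cod.
Proof.
have oV : open [set z : AP | V0 z.2].
  have -> : [set z : AP | V0 z.2] = [set z : AP | setT z /\ V0 z.2].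
    by apply/seteqP; split=> z //= [].
  apply: open_preimage; [exact: openT|exact: mg.1|].
  by move=> z _; exact: morphism_at_snd.
apply: open_preimage => //; first exact: open_chart.
by move=> z Vz; exact: morphism_at_comp (morphism_at_snd z rA rP) (mg.2 _ Vz).
Qed.

Lemma dense_family_dom t : dense (fibre family_dom t).
Proof.
apply: projective_dense; first exact: (open_fibre rA rP t open_family_dom).
apply: shear_preimage_neq0 => //; first exact: mf.1.
exact: projective_dense_neq0.
Qed.

Lemma dense_family_cod t : dense (fibre family_cod t).
Proof.
apply: projective_dense; first exact: (open_fibre rA rP t open_family_cod).
have [x [x0 Ux]] := projective_meet (@open_chart k n) mf.1 (@chart_neq0 k n)
  (projective_dense_neq0 dU0).
by have [Vfx gfx] := fK Ux; exists (f x); split=> //=; rewrite gfx.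
Qed.

Lemma familyK (z : AP) : family_dom z ->
  family_cod (z.1, family z) /\ family_inv (z.1, family z) = z.2.
Proof.
move=> [z0 Uz]; rewrite /family_cod /family_inv /= /family.
have [Vz ->] := fK Uz; rewrite shear_mapK //; split=> //; split=> //.
exact: (shear_map_chart cs hn _ z0).1.
Qed.

Lemma family_invK (z : AP) : family_cod z ->
  family_dom (z.1, family_inv z) /\ family (z.1, family_inv z) = z.2.
Proof.
move=> [Vz z0]; have [Uz fz] := gK Vz.
rewrite /family_dom /family /= /family_inv.
rewrite -[X in shear_map cs X (shear_map _ _ _)]opprK shear_mapK //.
split=> //; split=> //.
exact: (shear_map_chart cs hn _ z0).1.
Qed.

Lemma morphism_family_fibre t :
  morphism_on (fibre family_dom t) (fun x => family (t, x)).
Proof.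
split=> [|x tx]; first exact: (open_fibre rA rP t open_family_dom).
exact: morphism_at_comp (morphism_at_slice rA rP t x) (morphism_family tx).
Qed.

Lemma birational_family_fibre t :
  birational_on (fibre family_dom t) (fun x => family (t, x)).
Proof.
exists (fibre family_dom t), (fibre family_cod t), (fun y => family_inv (t, y)).
split; first by split; [exact: dense_family_dom | exact: dense_family_cod | ].
split.
- exact: morphism_family_fibre.
- split=> [|y ty]; first exact: (open_fibre rA rP t open_family_cod).
  exact: morphism_at_comp (morphism_at_slice rA rP t y) (morphism_family_inv ty).
- by move=> x /familyK.
- by move=> y /family_invK.
Qed.

Definition family_bir (t : A1) : Bir k n :=
  BirMap (bir_map := RatMap (dense_family_dom t) (morphism_family_fibre t))
    (birational_family_fibre t).

Definition family_map (z : AP) : AP := (z.1, family z).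

Lemma morphism_family_map : morphism_on family_dom family_map.
Proof.
split=> [|z Uz]; first exact: open_family_dom.
apply: morphism_at_pair => //; first exact: morphism_at_fst.
exact: morphism_family.
Qed.

Definition family_ratmap : ratmap AP AP :=
  RatMap (dense_fibres rA rP dense_family_dom) morphism_family_map.

Lemma birational_family : birational family_ratmap.
Proof.
exists family_dom, family_cod, (fun z => (z.1, family_inv z)).
split.
  split=> //; first exact: (dense_fibres rA rP dense_family_dom).
  exact: (dense_fibres rA rP dense_family_cod).
split.
- exact: morphism_family_map.
- split=> [|z Vz]; first exact: open_family_cod.
  apply: morphism_at_pair => //; first exact: morphism_at_fst.
  exact: morphism_family_inv.
- by case=> t x /familyK[? /= E]; split; rewrite //= E.
- by case=> t y /family_invK[? /= E]; split; rewrite //= /family_map /= E.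
Qed.

Lemma family_morphism : morphism_to_Bir family_bir.
Proof.
exists family_ratmap, family_dom, family; split.
  split=> //.
  - exact: birational_family.
  - split=> //; [exact: open_family_dom| |exact: dense_family_dom].
    exact: (dense_fibres rA rP dense_family_dom).
  - split=> [|z]; [exact: open_family_dom | exact: morphism_family].
  - by move=> t; split; [exact: morphism_family_fibre|exact: birational_family_fibre].
move=> t; exists (fibre family_dom t); split=> //.
- exact: (open_fibre rA rP t open_family_dom).
- exact: dense_family_dom.
Qed.

(** [shear_map cs 0] is known to be the identity on the chart only, which is enough for equality of
    rational maps. *)
Lemma family0 : ratmap_eq (family_bir 0) f.
Proof.
exists (fibre family_dom 0).
have p0 : param 0 = 0 by rewrite /param mxE.
split; [exact: (open_fibre rA rP 0 open_family_dom)|exact: dense_family_dom| |].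
  move=> x [x0 Ux]; split; first by split.
  by apply: U0f; move: Ux; rewrite /= p0 shear_map0.
by move=> x [x0 Ux]; rewrite /= /family /= p0 shear_map0.
Qed.

Lemma degree_family d e t : uniq cs -> size cs = (d + e)%N -> (0 < d)%N ->
  has_degree f d -> param t != 0 -> (e <= degree (family_bir t))%N.
Proof.
move=> ucs scs d0 fd t0.
have cs0 : (0 < size cs)%N by rewrite scs addn_gt0 d0.
have oW : open (fibre family_dom t) by exact: (open_fibre rA rP t open_family_dom).
apply: degree_ge => [|d' hd'].
  apply: (has_degree_shear (t := param t) hn cs0 fd oW (@dense_family_dom t)) => //.
  by move=> x [].
(* The choice of [d + e] hyperplanes pays off: [degree_shear_ge] gives d + e <= d + d'. *)
rewrite -(leq_add2l d) -scs.
apply: (degree_shear_ge hn t0 ucs cs0 fd hd' mf.1 (projective_dense_neq0 dU0) _ oW).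
- by move=> x y /fK[_ gx] /fK[_ gy] fxy; rewrite -gx -gy fxy.
- exact: projective_dense_neq0 (@dense_family_dom t).
- by move=> x [].
Qed.

End Family.

Theorem corollary29 (k : closedFieldType) (n : nat) (hn : (2 <= n)%N)
    (d e : nat) (hd : (0 < d)%N) (he : (0 < e)%N) (hde : (d <= e)%N)
    (f : Bir k n) (hf : degree f = d) :
  specialization_of_degrees_ge f e.
Proof.
have fd := degree_spec hd hf.
have [cs [ucs scs]] := exists_uniq_seq k (d + e).
have [U0 [V0 [g0 [[dU0 dV0 U0f] [mf mg fK gK]]]]] := bir_birational f.
exists (affine_space k 1); split; first exact: affine_space_variety.
split; first exact: affine_irreducible.
exists (family_bir cs hn dU0 mf mg fK gK).
split; first exact: family_morphism.
split; first by exists 0; exact: family0.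
have rA := @affine_ringed k 1.
have oW : open [set t : affine_space k 1 | param t != 0].
  by apply: (open_regular_neq0 rA) => t; exact: regular_coord.
exists [set t | param t != 0]; split=> //.
  move=> O O0 oO; apply: affine_meet => //.
  by exists (const_mx 1); rewrite /param /= mxE oner_neq0.
by move=> t t0; apply: (degree_family _ _ _ _ _ _ ucs scs hd fd t0).
Qed.
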